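(* Let $h$ be a left-invariant Lorentzian metric of nonzero constant sectional curvature on $\widetilde{\mathrm{SL}(2,\mathbb R)}$. Then $h$ is bi-invariant and, up to a nonzero scalar multiple, coincides with the left-invariant metric induced by the Killing form.
   Context: $\widetilde{\mathrm{SL}(2,\mathbb R)}$ is the universal covering group of $\mathrm{SL}(2,\mathbb R)$. Lorentzian means of signature $(-,+,+)$. The Killing form is that of the Lie algebra $\mathfrak{sl}(2,\mathbb R)$. *)

(* Defs.v *)
From HB Require Import structures.
From mathcomp Require Import all_boot all_order all_algebra.
From mathcomp Require Import ring lra.
From mathcomp Require Import all_classical all_reals all_analysis.

Set Implicit Arguments.
Unset Strict Implicit.
Unset Printing Implicit Defensive.

Import Order.TTheory GRing.Theory Num.Theory.
Import numFieldNormedType.Exports.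

Local Open Scope classical_set_scope.
Local Open Scope ring_scope.

(** * Pseudo-Riemannian metrics on the smooth manifold R^3, in the global
      chart; tangent vectors are row vectors in the coordinate basis. *)

Definition partial (R : realType) (i : 'I_3) (f : 'rV[R]_3 -> R) :
    'rV[R]_3 -> R :=
  fun x => 'D_(delta_mx 0 i) f x.

(* C^oo : every iterated partial derivative is differentiable. *)
Definition smooth (R : realType) (f : 'rV[R]_3 -> R) : Prop :=
  forall (s : seq 'I_3) (x : 'rV[R]_3),
    differentiable (foldr (@partial R) f s) x.

(* A metric is given by the field of its Gram matrices (g_ij). *)
Definition metric_ip (R : realType) (g : 'rV[R]_3 -> 'M[R]_3)
    (x v w : 'rV[R]_3) : R :=
  (v *m g x *m w^T) 0 0.

Definition lorentzian_metric (R : realType) (g : 'rV[R]_3 -> 'M[R]_3) : Prop :=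
  [/\ forall i j, smooth (fun x => g x i j),
      forall x, (g x)^T = g x &
      forall x, exists2 P : 'M[R]_3, P \in unitmx &
        P *m g x *m P^T = diag_mx (\row_j [:: -1; 1; 1]`_j)].

(* Gamma^k_ij of the Levi-Civita connection. *)
Definition christoffel (R : realType) (g : 'rV[R]_3 -> 'M[R]_3)
    (k i j : 'I_3) (x : 'rV[R]_3) : R :=
  2^-1 * \sum_(l < 3) invmx (g x) k l *
    (partial i (fun y => g y j l) x + partial j (fun y => g y i l) x
     - partial l (fun y => g y i j) x).

(* R(d_i, d_j) d_k = \sum_l (riemann g l k i j) d_l, where
   R(X, Y) Z = D_X D_Y Z - D_Y D_X Z - D_[X, Y] Z. *)
Definition riemann (R : realType) (g : 'rV[R]_3 -> 'M[R]_3)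
    (l k i j : 'I_3) (x : 'rV[R]_3) : R :=
  partial i (christoffel g l j k) x - partial j (christoffel g l i k) x
  + \sum_(m < 3) (christoffel g l i m x * christoffel g m j k x
                  - christoffel g l j m x * christoffel g m i k x).

Definition curvature (R : realType) (g : 'rV[R]_3 -> 'M[R]_3)
    (x u v w : 'rV[R]_3) : 'rV[R]_3 :=
  \row_l \sum_(i < 3) \sum_(j < 3) \sum_(k < 3)
    u 0 i * v 0 j * w 0 k * riemann g l k i j x.

Definition plane_discr (R : realType) (g : 'rV[R]_3 -> 'M[R]_3)
    (x v w : 'rV[R]_3) : R :=
  metric_ip g x v v * metric_ip g x w w - metric_ip g x v w ^+ 2.

Definition sectional_curvature (R : realType) (g : 'rV[R]_3 -> 'M[R]_3)
    (x v w : 'rV[R]_3) : R :=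
  metric_ip g x (curvature g x v w w) v / plane_discr g x v w.

(* Only the nondegenerate planes have a sectional curvature. *)
Definition constant_sectional_curvature (R : realType)
    (g : 'rV[R]_3 -> 'M[R]_3) (K : R) : Prop :=
  forall x v w : 'rV[R]_3,
    plane_discr g x v w != 0 -> sectional_curvature g x v w = K.

(** * The universal covering group of SL(2,R)

    By the Iwasawa decomposition, (theta, s, u) |-> R(theta) A(s) N(u) maps
    the simply connected manifold R^3 onto SL(2,R), and its fibres are the
    orbits of theta |-> theta + 2 pi: it is the universal covering of SL(2,R).
    The group law of SL(2,R) lifts to a unique continuous group law on R^3
    with unit 0, which is defined explicitly.  See [covering_surj],
    [covering_fiber], [coveringM], [mulGA], [mul1G], [mulVG],
    [differentiable_mulG]. *)

Definition mx2 (R : realType) (a b c d : R) : 'M[R]_2 :=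
  \matrix_(i, j) (if i == 0 then (if j == 0 then a else b)
                  else (if j == 0 then c else d)).

Definition rotmx (R : realType) (t : R) : 'M[R]_2 :=
  mx2 (cos t) (- sin t) (sin t) (cos t).

Definition dilmx (R : realType) (s : R) : 'M[R]_2 :=
  mx2 (expR s) 0 0 (expR (- s)).

Definition shearmx (R : realType) (u : R) : 'M[R]_2 := mx2 1 u 0 1.

Definition pt (R : realType) (t s u : R) : 'rV[R]_3 := \row_j [:: t; s; u]`_j.

Definition covering (R : realType) (x : 'rV[R]_3) : 'M[R]_2 :=
  rotmx (x 0 0) *m dilmx (x 0 1) *m shearmx (x 0 2).

(* The product A(s) N(u) R(t) of the last two Iwasawa factors of x and the
   first one of y. *)
Definition mid (R : realType) (s u t : R) : 'M[R]_2 :=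
  dilmx s *m shearmx u *m rotmx t.

(* Iwasawa decomposition mid s u t = R(iw_angle) A(ln iw_norm) N(iw_shear).
   A(s) N(u) has only positive eigenvalues, so it never maps a vector to a
   negative multiple of itself: the first column of mid s u t makes with
   (cos t, sin t) an angle in ]-pi, pi[, which is 2 atan (b / (r + a)) if a
   and b are the components of that column along (cos t, sin t) and
   (- sin t, cos t), and r is its length. *)
Definition iw_norm (R : realType) (s u t : R) : R :=
  Num.sqrt (mid s u t 0 0 ^+ 2 + mid s u t 1 0 ^+ 2).

Definition iw_shear (R : realType) (s u t : R) : R :=
  (mid s u t 0 0 * mid s u t 0 1 + mid s u t 1 0 * mid s u t 1 1)
  / iw_norm s u t ^+ 2.

Definition iw_angle (R : realType) (s u t : R) : R :=
  t + 2 * atan ((mid s u t 1 0 * cos t - mid s u t 0 0 * sin t) /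
                (iw_norm s u t
                 + (mid s u t 0 0 * cos t + mid s u t 1 0 * sin t))).

Definition mulG (R : realType) (x y : 'rV[R]_3) : 'rV[R]_3 :=
  pt (x 0 0 + iw_angle (x 0 1) (x 0 2) (y 0 0))
     (ln (iw_norm (x 0 1) (x 0 2) (y 0 0)) + y 0 1)
     (expR (- (2 * y 0 1)) * iw_shear (x 0 1) (x 0 2) (y 0 0) + y 0 2).

(* (R(t) A(s) N(u))^-1 = (N(-u) A(-s)) R(-t) = A(-s) N(- e^(2s) u) R(-t) *)
Definition invG (R : realType) (x : 'rV[R]_3) : 'rV[R]_3 :=
  mulG (pt 0 (- x 0 1) (- (expR (2 * x 0 1) * x 0 2))) (pt (- x 0 0) 0 0).

Definition left_invariant (R : realType) (g : 'rV[R]_3 -> 'M[R]_3) : Prop :=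
  forall a x v w : 'rV[R]_3,
    metric_ip g (mulG a x) ('d (mulG a) x v) ('d (mulG a) x w)
    = metric_ip g x v w.

Definition right_invariant (R : realType) (g : 'rV[R]_3 -> 'M[R]_3) : Prop :=
  forall a x v w : 'rV[R]_3,
    metric_ip g (mulG x a) ('d ((@mulG R)^~ a) x v) ('d ((@mulG R)^~ a) x w)
    = metric_ip g x v w.

Definition bi_invariant (R : realType) (g : 'rV[R]_3 -> 'M[R]_3) : Prop :=
  left_invariant g /\ right_invariant g.

Definition lie (R : realType) (X Y : 'M[R]_2) : 'M[R]_2 := X *m Y - Y *m X.

(* The basis H, E, F of sl(2,R), see [sl2_basis_free] and
   [sl2_basis_span]. *)
Definition sl2_basis (R : realType) : 3.-tuple 'M[R]_2 :=
  [tuple mx2 1 0 0 (-1); mx2 0 1 0 0; mx2 0 0 1 0].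

(* The trace of ad X \o ad Y on sl(2,R). *)
Definition killing (R : realType) (X Y : 'M[R]_2) : R :=
  \sum_(i < 3) coord (sl2_basis R) i (lie X (lie Y (sl2_basis R)`_i)).

(* The tangent space at the unit is identified with sl(2,R) by the
   differential of the covering map, and the form is moved to the tangent
   space at x by the left translation of x^-1. *)
Definition killing_metric (R : realType) (x v w : 'rV[R]_3) : R :=
  killing ('d (@covering R) (0 : 'rV[R]_3) ('d (mulG (invG x)) x v))
          ('d (@covering R) (0 : 'rV[R]_3) ('d (mulG (invG x)) x w)).

Lemma ptE (R : realType) (t s u : R) :
  (pt t s u 0 0 = t) * (pt t s u 0 1 = s) * (pt t s u 0 2 = u).
Proof. by rewrite !mxE. Qed.

Lemma eq_pt (R : realType) (x : 'rV[R]_3) : x = pt (x 0 0) (x 0 1) (x 0 2).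
Proof.
apply/rowP => j; rewrite mxE.
by case: j => [[|[|[|//]]] p] /=; congr (x _ _); apply: val_inj.
Qed.

Lemma pt0 (R : realType) : pt 0 0 0 = 0 :> 'rV[R]_3.
Proof. by rewrite [RHS]eq_pt !mxE. Qed.

Lemma mx2E (R : realType) (a b c d : R) :
  (mx2 a b c d 0 0 = a) * (mx2 a b c d 0 1 = b) *
  (mx2 a b c d 1 0 = c) * (mx2 a b c d 1 1 = d).
Proof. by rewrite !mxE. Qed.

Lemma eq_mx2 (R : realType) (A : 'M[R]_2) :
  A = mx2 (A 0 0) (A 0 1) (A 1 0) (A 1 1).
Proof.
apply/matrixP => i j; rewrite mxE.
by case: i => [[|[|//]] p]; case: j => [[|[|//]] q] /=;
  congr (A _ _); apply: val_inj.
Qed.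

Lemma mx2M (R : realType) (a b c d a' b' c' d' : R) :
  mx2 a b c d *m mx2 a' b' c' d' =
  mx2 (a * a' + b * c') (a * b' + b * d') (c * a' + d * c') (c * b' + d * d').
Proof.
by rewrite [LHS]eq_mx2 !mxE !big_ord_recl !big_ord0 !mxE /= !addr0.
Qed.

Lemma det_mx2 (R : realType) (a b c d : R) : \det (mx2 a b c d) = a * d - b * c.
Proof. by rewrite (expand_det_row _ 0) big_ord_recl big_ord1 /cofactor !det_mx11 !mxE /= /bump /=; ring. Qed.

Lemma midE (R : realType) (s u t : R) :
  mid s u t = mx2 (expR s * (cos t + u * sin t)) (expR s * (u * cos t - sin t))
                  (expR (- s) * sin t) (expR (- s) * cos t).
Proof. by rewrite /mid /dilmx /shearmx /rotmx !mx2M; congr mx2; ring. Qed.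

Lemma expRMN (R : realType) (s : R) : expR s * expR (- s) = 1.
Proof. by rewrite -expRD subrr expR0. Qed.

Lemma det_mid (R : realType) (s u t : R) : \det (mid s u t) = 1.
Proof.
rewrite midE det_mx2.
rewrite (_ : _ - _ = expR s * expR (- s) * (cos t ^+ 2 + sin t ^+ 2)); last by ring.
by rewrite expRMN cos2Dsin2 mulr1.
Qed.

Lemma iw_norm_gt0 (R : realType) (s u t : R) : 0 < iw_norm s u t.
Proof.
rewrite /iw_norm sqrtr_gt0 lt_neqAle addr_ge0 ?sqr_ge0 // andbT eq_sym.
rewrite paddr_eq0 ?sqr_ge0 // !sqrf_eq0.
apply/negP => /andP[/eqP h0 /eqP h1].
have := det_mid s u t; rewrite [mid _ _ _]eq_mx2 det_mx2 h0 h1.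
by move/eqP; rewrite mul0r mulr0 subrr eq_sym oner_eq0.
Qed.

Lemma iw_norm2 (R : realType) (s u t : R) :
  iw_norm s u t ^+ 2 = mid s u t 0 0 ^+ 2 + mid s u t 1 0 ^+ 2.
Proof. by rewrite sqr_sqrtr // addr_ge0 ?sqr_ge0. Qed.

Lemma iw_den_gt0 (R : realType) (s u t : R) :
  0 < iw_norm s u t + (mid s u t 0 0 * cos t + mid s u t 1 0 * sin t).
Proof.
have r0 := iw_norm_gt0 s u t; have r2 := iw_norm2 s u t.
set r := iw_norm s u t in r0 r2 *.
set a := mid s u t 0 0 in r2 *; set b := mid s u t 1 0 in r2 *.
have cs := cos2Dsin2 t.
have r2' : r ^+ 2 = (a * cos t + b * sin t) ^+ 2 + (b * cos t - a * sin t) ^+ 2.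
  rewrite r2 -[LHS]mulr1 -cs; ring.
rewrite ltNge; apply/negP => le0.
have ge : r ^+ 2 <= (a * cos t + b * sin t) ^+ 2 by nra.
have beta0 : (b * cos t - a * sin t) ^+ 2 = 0.
  by apply/eqP; rewrite eq_le sqr_ge0 andbT; lra.
move/eqP: (beta0); rewrite sqrf_eq0 => /eqP beta0'.
have alpha : a * cos t + b * sin t = - r.
  have /eqP : (a * cos t + b * sin t) ^+ 2 = r ^+ 2 by rewrite r2' beta0 addr0.
  rewrite eqf_sqr => /orP[/eqP|/eqP//] e; lra.
have ha : a = - r * cos t.
  rewrite -alpha -[LHS]mulr1 -cs.
  transitivity ((a * cos t + b * sin t) * cos t - (b * cos t - a * sin t) * sin t).
    ring.
  by rewrite beta0' mul0r subr0.
have hb : b = - r * sin t.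
  rewrite -alpha -[LHS]mulr1 -cs.
  transitivity ((a * cos t + b * sin t) * sin t + (b * cos t - a * sin t) * cos t).
    ring.
  by rewrite beta0' mul0r addr0.
have s0 : sin t = 0.
  move/eqP: hb; rewrite /b midE mx2E -subr_eq0 -mulrBl opprK mulf_eq0.
  case/orP => [|/eqP//]; rewrite gt_eqF // addr_gt0 ?expR_gt0 //.
have c0 : cos t = 0.
  move/eqP: ha; rewrite /a midE mx2E s0 mulr0 addr0 -subr_eq0 -mulrBl opprK.
  rewrite mulf_eq0 => /orP[|/eqP//]; rewrite gt_eqF // addr_gt0 ?expR_gt0 //.
by move: cs; rewrite s0 c0 expr0n addr0 => /eqP; rewrite eq_sym oner_eq0.
Qed.

Lemma cos_sin_2atan (R : realType) (r a b : R) : 0 < r -> 0 < r + a ->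
  r ^+ 2 = a ^+ 2 + b ^+ 2 ->
  cos (2 * atan (b / (r + a))) = a / r /\ sin (2 * atan (b / (r + a))) = b / r.
Proof.
move=> r0 ra0 e; set z := b / (r + a).
have rn : r != 0 by rewrite gt_eqF.
have ran : r + a != 0 by rewrite gt_eqF.
have z2 : 1 + z ^+ 2 = 2 * r / (r + a).
  apply: (mulIf (expf_neq0 2 ran)); rewrite /z expr_div_n.
  have -> : (1 + b ^+ 2 / (r + a) ^+ 2) * (r + a) ^+ 2 = (r + a) ^+ 2 + b ^+ 2.
    by field.
  have -> : 2 * r / (r + a) * (r + a) ^+ 2 = 2 * r * (r + a) by field.
  have -> : b ^+ 2 = r ^+ 2 - a ^+ 2 by rewrite e; ring.
  ring.
have z2p : 0 < 1 + z ^+ 2 by rewrite ltr_wpDr ?sqr_ge0.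
have c2 : cos (atan z) ^+ 2 = (r + a) / (2 * r).
  rewrite cos_atan exprVn sqr_sqrtr ?ltW // z2 invfM invrK.
  by field; rewrite ?rn ?ran.
have cn : cos (atan z) != 0.
  by rewrite cos_atan invr_neq0 // gt_eqF // sqrtr_gt0.
have sz : sin (atan z) = z * cos (atan z).
  by apply: (mulIf (invr_neq0 cn)); rewrite mulfK // -[LHS]/(tan (atan z)) atanK.
have -> : 2 * atan z = atan z *+ 2 by rewrite mulr_natl.
have zr : z * (r + a) = b by rewrite /z divfK.
have h : (r + a) / (2 * r) *+ 2 = 1 + a / r.
  by rewrite -mulr_natl; field; rewrite ?rn.
rewrite cos_mulr2n sin_mulr2n sz c2; split; first by rewrite h; ring.
have -> : cos (atan z) * (z * cos (atan z)) = z * cos (atan z) ^+ 2 by ring.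
rewrite c2 -mulrnAr h.
have -> : 1 + a / r = (r + a) / r by field.
by rewrite mulrA zr.
Qed.

Lemma cos_iw_angle (R : realType) (s u t : R) :
  cos (iw_angle s u t) = mid s u t 0 0 / iw_norm s u t /\
  sin (iw_angle s u t) = mid s u t 1 0 / iw_norm s u t.
Proof.
have r0 := iw_norm_gt0 s u t; have r2 := iw_norm2 s u t.
have d0 := iw_den_gt0 s u t.
rewrite /iw_angle.
set r := iw_norm s u t in r0 r2 d0 *.
set a := mid s u t 0 0 in r2 d0 *; set b := mid s u t 1 0 in r2 d0 *.
have cs := cos2Dsin2 t.
have [] := @cos_sin_2atan _ r (a * cos t + b * sin t) (b * cos t - a * sin t) r0 d0 _.
  rewrite r2 -[LHS]mulr1 -cs; ring.
move=> ec es; rewrite cosD sinD ec es; split.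
- transitivity (a * (cos t ^+ 2 + sin t ^+ 2) / r); first ring.
  by rewrite cs mulr1.
- transitivity (b * (cos t ^+ 2 + sin t ^+ 2) / r); first ring.
  by rewrite cs mulr1.
Qed.

Lemma iw_decomp (R : realType) (s u t : R) :
  mid s u t = rotmx (iw_angle s u t) *m dilmx (ln (iw_norm s u t))
              *m shearmx (iw_shear s u t).
Proof.
have r0 := iw_norm_gt0 s u t; have r2 := iw_norm2 s u t.
have dm := det_mid s u t; rewrite [mid _ _ _]eq_mx2 det_mx2 in dm.
have [ec es] := cos_iw_angle s u t.
rewrite /rotmx /dilmx /shearmx expRN lnK ?posrE // ec es !mx2M /iw_shear.
rewrite [LHS]eq_mx2; set r := iw_norm s u t in r0 r2 *.
set a := mid s u t 0 0 in r2 dm *; set b := mid s u t 1 0 in r2 dm *.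
set c := mid s u t 0 1 in dm *; set d := mid s u t 1 1 in dm *.
have rn : r != 0 by rewrite gt_eqF.
congr mx2.
- by field.
- transitivity ((a * (a * c + b * d) - b * (a * d - c * b)) / r ^+ 2).
    rewrite [r ^+ 2]r2; field; rewrite -r2 expf_neq0 //.
  by rewrite dm; field.
- by field.
- transitivity ((b * (a * c + b * d) + a * (a * d - c * b)) / r ^+ 2).
    rewrite [r ^+ 2]r2; field; rewrite -r2 expf_neq0 //.
  by rewrite dm; field.
Qed.

Lemma rotD (R : realType) (s t : R) : rotmx (s + t) = rotmx s *m rotmx t.
Proof. by rewrite /rotmx mx2M cosD sinD; congr mx2; ring. Qed.

Lemma det_covering (R : realType) (x : 'rV[R]_3) : \det (covering x) = 1.
Proof.
have cs := cos2Dsin2 (x 0 0).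
by rewrite /covering !det_mulmx !det_mx2 expRMN mulNr opprK -!expr2 cs; ring.
Qed.

Lemma coveringM (R : realType) (x y : 'rV[R]_3) :
  covering (mulG x y) = covering x *m covering y.
Proof.
rewrite /covering /mulG !ptE rotD.
set th := iw_angle _ _ _; set r := iw_norm _ _ _; set k := iw_shear _ _ _.
transitivity (rotmx (x 0 0) *m (rotmx th *m dilmx (ln r) *m shearmx k) *m dilmx (y 0 1) *m shearmx (y 0 2)).
  rewrite -!mulmxA; congr (_ *m (_ *m _)); rewrite /dilmx /shearmx !mx2M.
  rewrite opprD !expRD; have := expRMN (y 0 1); set E := expR (y 0 1).
  have -> : expR (- (2 * y 0 1)) = expR (- y 0 1) ^+ 2.
    by rewrite -expRM_natl mulrN.
  set F := expR (- y 0 1) => EF; congr mx2; rewrite ?(mulr0, mul0r, addr0, add0r, mulr1, mul1r) //; try ring.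
  transitivity (expR (ln r) * E * y 0 2 + expR (ln r) * k * F * (E * F)); first ring.
  by rewrite EF; ring.
by rewrite -iw_decomp /mid !mulmxA.
Qed.

Lemma exists_angle (R : realType) (p q : R) : p ^+ 2 + q ^+ 2 = 1 ->
  exists t, cos t = p /\ sin t = q.
Proof.
move=> e; have p1 : -1 <= p by nra.
move: p1; rewrite le_eqVlt => /predU1P[pN1|p1].
  exists pi; rewrite cospi sinpi; split=> //.
  have : q ^+ 2 = 0 by nra.
  by move/eqP; rewrite sqrf_eq0 => /eqP ->.
exists (2 * atan (q / (1 + p))).
have [|||-> ->] := @cos_sin_2atan R 1 p q; rewrite ?divr1 ?e ?expr1n //.
lra.
Qed.

Lemma covering_surj (R : realType) (A : 'M[R]_2) :
  \det A = 1 -> exists x, covering x = A.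
Proof.
rewrite [A]eq_mx2 det_mx2.
set a := A 0 0; set b := A 0 1; set c := A 1 0; set d := A 1 1 => dA.
have r2 : 0 < a ^+ 2 + c ^+ 2.
  rewrite lt_neqAle addr_ge0 ?sqr_ge0 // andbT eq_sym.
  rewrite paddr_eq0 ?sqr_ge0 // !sqrf_eq0; apply/negP => /andP[/eqP h0 /eqP h1].
  by move/eqP: dA; rewrite h0 h1 mul0r mulr0 subrr eq_sym oner_eq0.
pose r := Num.sqrt (a ^+ 2 + c ^+ 2).
have r0 : 0 < r by rewrite sqrtr_gt0.
have rn : r != 0 by rewrite gt_eqF.
have er : r ^+ 2 = a ^+ 2 + c ^+ 2 by rewrite sqr_sqrtr // ltW.
have [t [ct st]] : exists t, cos t = a / r /\ sin t = c / r.
  by apply: exists_angle; rewrite !expr_div_n -mulrDl -er divff // expf_neq0.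
exists (pt t (ln r) ((a * b + c * d) / r ^+ 2)).
rewrite /covering !ptE /rotmx /dilmx /shearmx expRN lnK ?posrE // ct st !mx2M.
congr mx2.
- by field.
- transitivity ((a * (a * b + c * d) - c * (a * d - b * c)) / r ^+ 2).
    by rewrite dA; field.
  rewrite [r ^+ 2]er; field; rewrite -er expf_neq0 //.
- by field.
- transitivity ((c * (a * b + c * d) + a * (a * d - b * c)) / r ^+ 2).
    by rewrite dA; field.
  rewrite [r ^+ 2]er; field; rewrite -er expf_neq0 //.
Qed.

Lemma cos_sin_period (R : realType) (a : R) (k : int) :
  cos (a + k%:~R * (pi *+ 2)) = cos a /\ sin (a + k%:~R * (pi *+ 2)) = sin a.
Proof.
have per (n : nat) b : cos (b + n%:R * (pi *+ 2)) = cos b :> R /\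
    sin (b + n%:R * (pi *+ 2)) = sin b :> R.
  rewrite mulr_natl (periodicn (@cosD2pi R)) (periodicn (@sinD2pi R)).
  by split.
case: k => n; first exact: per.
rewrite NegzE mulrNz mulNr; have := per n.+1 (a - n.+1%:~R * (pi *+ 2)).
by rewrite subrK => -[-> ->].
Qed.

Lemma cos_eq1 (R : realType) (d : R) :
  cos d = 1 -> exists k : int, d = k%:~R * (pi *+ 2).
Proof.
move=> cd; pose k := Num.floor (d / (pi *+ 2)).
have p0 := pi_gt0 R; have pp : 0 < pi *+ 2 :> R by rewrite pmulrn_lgt0.
exists k; set e := d - k%:~R * (pi *+ 2).
have de : d = e + k%:~R * (pi *+ 2) by rewrite subrK.
suff -> : d = 0 + k%:~R * (pi *+ 2) by rewrite add0r.
rewrite de; congr (_ + _).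
have ce : cos e = 1 by rewrite -cd de; case: (cos_sin_period e k).
have e0 : 0 <= e by rewrite subr_ge0 -ler_pdivlMr // floor_le_tmp.
have e1 : e < pi *+ 2.
  rewrite ltrBlDr -[X in X + _]mul1r -mulrDl -ltr_pdivrMr //.
  by have := floorD1_gt (d / (pi *+ 2)); rewrite intrD addrC.
apply/eqP; rewrite eq_le e0 andbT leNgt; apply/negP => ep.
have : 0 < sin (e / 2).
  apply: sin_gt0_pi; rewrite divr_gt0 //= ltr_pdivrMr // mulr_natr //.
have : cos (e / 2 *+ 2) = 1 by rewrite -mulr_natr divfK.
rewrite cos_mulr2n cos2sin2; set sn := sin _; nra.
Qed.

Lemma covering_fiber (R : realType) (x y : 'rV[R]_3) :
  covering x = covering y <->
  exists k : int, x = y + pt (k%:~R * (pi *+ 2)) 0 0.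
Proof.
split; last first.
  case=> k ->; rewrite /covering !mxE /= !addr0 /rotmx.
  by case: (cos_sin_period (y 0 0) k) => -> ->.
rewrite /covering /rotmx /dilmx /shearmx !mx2M => e.
have e00 := congr1 (fun A : 'M[R]_2 => A 0 0) e.
have e01 := congr1 (fun A : 'M[R]_2 => A 0 1) e.
have e10 := congr1 (fun A : 'M[R]_2 => A 1 0) e.
have e11 := congr1 (fun A : 'M[R]_2 => A 1 1) e.
rewrite /= !mx2E !(mulr0, addr0, add0r, mulr1) in e00 e01 e10 e11.
have E0 := expR_gt0 (x 0 1); have F0 := expR_gt0 (y 0 1).
have cx := cos2Dsin2 (x 0 0); have cy := cos2Dsin2 (y 0 0).
have EF : expR (x 0 1) = expR (y 0 1).
  have : expR (x 0 1) ^+ 2 = expR (y 0 1) ^+ 2.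
    rewrite -[LHS]mul1r -cx -[RHS]mul1r -cy.
    transitivity ((cos (x 0 0) * expR (x 0 1)) ^+ 2 + (sin (x 0 0) * expR (x 0 1)) ^+ 2).
      ring.
    by rewrite e00 e10; ring.
  by move/eqP; rewrite eqf_sqr => /orP[/eqP //|/eqP]; lra.
have s1 : x 0 1 = y 0 1 := expR_inj EF.
have En : expR (x 0 1) != 0 by rewrite gt_eqF.
have c0 : cos (x 0 0) = cos (y 0 0) by apply: (mulIf En); rewrite e00 EF.
have s0 : sin (x 0 0) = sin (y 0 0) by apply: (mulIf En); rewrite e10 EF.
have u2 : x 0 2 = y 0 2.
  apply: (mulfI En).
  rewrite -[LHS]mul1r -[RHS]mul1r -cx.
  move: e01 e11; rewrite c0 s0 -s1.
  set E := expR _; set N := expR _; move=> e01 e11.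
  transitivity (cos (y 0 0) * (cos (y 0 0) * E * x 0 2 + - sin (y 0 0) * N)
    + sin (y 0 0) * (sin (y 0 0) * E * x 0 2 + cos (y 0 0) * N)); first by ring.
  by rewrite e01 e11; ring.
have [|k ek] := @cos_eq1 R (x 0 0 - y 0 0).
  by rewrite cosB c0 s0 -!expr2.
exists k; rewrite [x]eq_pt [LHS](_ : _ = pt (y 0 0 + (x 0 0 - y 0 0)) (x 0 1) (x 0 2)); last first.
  by rewrite addrCA subrr addr0.
rewrite ek s1 u2; apply/rowP => j; rewrite !mxE.
case: j => [[|[|[|//]]] p] /=; rewrite ?addr0 //; do ?congr (_ + _); congr (y _ _); exact: val_inj.
Qed.

Lemma iw_angle0 (R : realType) (s u : R) : iw_angle s u 0 = 0.
Proof.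
by rewrite /iw_angle midE !mx2E sin0 cos0 !(mulr0, mul0r) subrr mul0r atan0 mulr0 addr0.
Qed.

Lemma differentiable_fun_comp (R : realType) (V : normedModType R) (f : R -> R)
    (g : V -> R) (x : V) :
  derivable f (g x) 1 -> differentiable g x -> differentiable (fun y => f (g y)) x.
Proof.
by move=> /derivable1_diffP df dg; exact: (@differentiable_comp R V _ _ g f).
Qed.

Lemma differentiable_mid (R : realType) (V : normedModType R) (s u t : V -> R)
    (x : V) (i j : 'I_2) :
  differentiable s x -> differentiable u x -> differentiable t x ->
  differentiable (fun y => mid (s y) (u y) (t y) i j) x.
Proof.
move=> ds du dt.
have dc : differentiable (fun y => cos (t y)) x.
  by apply: differentiable_fun_comp => //; exact: derivable_cos.
have dn : differentiable (fun y => sin (t y)) x.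
  by apply: differentiable_fun_comp => //; exact: derivable_sin.
have dE : differentiable (fun y => expR (s y)) x.
  by apply: differentiable_fun_comp => //; exact: derivable_expR.
have dF : differentiable (fun y => expR (- s y)) x.
  apply: (@differentiable_fun_comp R V expR (fun y => - s y)) => //.
  exact: differentiableN.
have -> : (fun y => mid (s y) (u y) (t y) i j) =
    (if i == 0 then
       if j == 0 then fun y => expR (s y) * (cos (t y) + u y * sin (t y))
       else fun y => expR (s y) * (u y * cos (t y) - sin (t y))
     else
       if j == 0 then fun y => expR (- s y) * sin (t y)
       else fun y => expR (- s y) * cos (t y)).
  by apply/funext => y; rewrite midE mxE; case: (i == 0); case: (j == 0).
case: (i == 0); case: (j == 0).
- apply: (@differentiableM _ _ (fun y => expR (s y))
    (fun y => cos (t y) + u y * sin (t y))) => //.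
  apply: (@differentiableD _ _ _ (fun y => cos (t y)) (fun y => u y * sin (t y))) => //.
  exact: differentiableM.
- apply: (@differentiableM _ _ (fun y => expR (s y))
    (fun y => u y * cos (t y) - sin (t y))) => //.
  apply: (@differentiableB _ _ _ (fun y => u y * cos (t y)) (fun y => sin (t y))) => //.
  exact: differentiableM.
- exact: differentiableM.
- exact: differentiableM.
Qed.

Lemma differentiable_iw_norm (R : realType) (V : normedModType R)
    (s u t : V -> R) (x : V) :
  differentiable s x -> differentiable u x -> differentiable t x ->
  differentiable (fun y => iw_norm (s y) (u y) (t y)) x.
Proof.
move=> ds du dt.
have dm i j : differentiable (fun y => mid (s y) (u y) (t y) i j) x.
  exact: differentiable_mid.
apply: (@differentiable_fun_comp R V Num.sqrt (fun y =>
  mid (s y) (u y) (t y) 0 0 ^+ 2 + mid (s y) (u y) (t y) 1 0 ^+ 2)).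
  apply: ex_derive; apply: is_derive1_sqrt.
  by rewrite -iw_norm2 exprn_gt0 // iw_norm_gt0.
by apply: differentiableD; apply: differentiableM.
Qed.

Lemma differentiable_iw_shear (R : realType) (V : normedModType R)
    (s u t : V -> R) (x : V) :
  differentiable s x -> differentiable u x -> differentiable t x ->
  differentiable (fun y => iw_shear (s y) (u y) (t y)) x.
Proof.
move=> ds du dt.
have dm i j : differentiable (fun y => mid (s y) (u y) (t y) i j) x.
  exact: differentiable_mid.
apply: differentiableM; first by apply: differentiableD; apply: differentiableM.
apply: differentiableV.
  by apply: differentiableM; exact: differentiable_iw_norm.
by rewrite gt_eqF // exprn_gt0 // iw_norm_gt0.
Qed.

Lemma differentiable_iw_angle (R : realType) (V : normedModType R)
    (s u t : V -> R) (x : V) :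
  differentiable s x -> differentiable u x -> differentiable t x ->
  differentiable (fun y => iw_angle (s y) (u y) (t y)) x.
Proof.
move=> ds du dt.
have dm i j : differentiable (fun y => mid (s y) (u y) (t y) i j) x.
  exact: differentiable_mid.
have dc : differentiable (fun y => cos (t y)) x.
  by apply: differentiable_fun_comp => //; exact: derivable_cos.
have dn : differentiable (fun y => sin (t y)) x.
  by apply: differentiable_fun_comp => //; exact: derivable_sin.
apply: differentiableD => //.
apply: differentiableM; first exact: differentiable_cst.
apply: differentiable_fun_comp; first exact: derivable_atan.
apply: differentiableM.
  by apply: differentiableB; apply: differentiableM.
apply: differentiableV; last by rewrite gt_eqF // iw_den_gt0.
apply: differentiableD; first exact: differentiable_iw_norm.
by apply: differentiableD; apply: differentiableM.
Qed.

Lemma differentiable_pt (R : realType) (V : normedModType R)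
    (s u t : V -> R) (x : V) :
  differentiable s x -> differentiable u x -> differentiable t x ->
  differentiable (fun y => pt (s y) (u y) (t y)) x.
Proof.
move=> ds du dt.
have -> : (fun y => pt (s y) (u y) (t y)) = (fun y => s y *: delta_mx 0 0)
    + (fun y => u y *: delta_mx 0 1) + (fun y => t y *: (delta_mx 0 2 : 'rV[R]_3)).
  apply/funext => y; rewrite [RHS]eq_pt /= !mxE /=.
  by rewrite !(mulr0, mulr1, addr0, add0r).
by apply: differentiableD; [apply: differentiableD|]; apply: differentiableZl.
Qed.

Lemma differentiable_mulG (R : realType) (V : normedModType R)
    (f g : V -> 'rV[R]_3) (x : V) :
  differentiable f x -> differentiable g x ->
  differentiable (fun y => mulG (f y) (g y)) x.
Proof.
move=> df dg.
have dfc i : differentiable (fun y => f y 0 i) x.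
  apply: (@differentiable_comp R V _ _ f (fun M : 'rV[R]_3 => M 0 i)) => //.
  exact: differentiable_coord.
have dgc i : differentiable (fun y => g y 0 i) x.
  apply: (@differentiable_comp R V _ _ g (fun M : 'rV[R]_3 => M 0 i)) => //.
  exact: differentiable_coord.
apply: differentiable_pt.
- by apply: differentiableD => //; exact: differentiable_iw_angle.
- apply: differentiableD => //.
  apply: differentiable_fun_comp; last exact: differentiable_iw_norm.
  by apply: ex_derive; apply: is_derive1_ln; exact: iw_norm_gt0.
- apply: differentiableD => //; apply: differentiableM; last exact: differentiable_iw_shear.
  apply: (@differentiable_fun_comp R V expR (fun y => - (2 * g y 0 1))).
    exact: derivable_expR.
  by apply: differentiableN; apply: differentiableM.
Qed.

Lemma differentiable_mulGl (R : realType) (a x : 'rV[R]_3) :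
  differentiable (mulG a) x.
Proof. exact: (@differentiable_mulG R _ (cst a) id). Qed.

Lemma differentiable_mulGr (R : realType) (a x : 'rV[R]_3) :
  differentiable ((@mulG R)^~ a) x.
Proof. exact: (@differentiable_mulG R _ id (cst a)). Qed.

Lemma differentiable_covering (R : realType) (x : 'rV[R]_3) :
  differentiable (@covering R) x.
Proof.
have dx (i : 'I_3) : differentiable (fun y : 'rV[R]_3 => y 0 i) x.
  exact: differentiable_coord.
have dr i j : differentiable (fun y : 'rV[R]_3 => rotmx (y 0 0) i j) x.
  have -> : (fun y : 'rV[R]_3 => rotmx (y 0 0) i j) =
      (fun y => mid (cst 0 y) (cst 0 y) (y 0 0) i j).
    by apply/funext => y; rewrite midE /rotmx !mxE oppr0 expR0 !mul1r !mul0r addr0 sub0r.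
  by apply: differentiable_mid.
have dk i j : differentiable (fun y : 'rV[R]_3 => (dilmx (y 0 1) *m shearmx (y 0 2)) i j) x.
  have -> : (fun y : 'rV[R]_3 => (dilmx (y 0 1) *m shearmx (y 0 2)) i j) =
      (fun y => mid (y 0 1) (y 0 2) (cst 0 y) i j).
    apply/funext => y; rewrite /mid [rotmx 0](_ : _ = 1) ?mulmx1 //.
    by rewrite /rotmx sin0 cos0 oppr0 [RHS]eq_mx2 !mxE.
  by apply: differentiable_mid.
pose e (i j : 'I_2) (y : 'rV[R]_3) : 'M[R]_2 := covering y i j *: delta_mx i j.
have -> : @covering R = \sum_(i < 2) \sum_(j < 2) e i j.
  apply/funext => y; rewrite [LHS]matrix_sum_delta fct_sumE.
  by apply: eq_bigr => i _; rewrite fct_sumE.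
apply: differentiable_sum => i; apply: differentiable_sum => j.
apply: differentiableZl.
have -> : (fun y : 'rV[R]_3 => covering y i j) = (fun y =>
    rotmx (y 0 0) i 0 * (dilmx (y 0 1) *m shearmx (y 0 2)) 0 j
    + rotmx (y 0 0) i 1 * (dilmx (y 0 1) *m shearmx (y 0 2)) 1 j).
  apply/funext => y; rewrite /covering -mulmxA mxE !big_ord_recl big_ord0 addr0.
  by have -> : lift ord0 ord0 = 1 :> 'I_2 by exact: val_inj.
by apply: differentiableD; apply: differentiableM.
Qed.

Lemma continuous_iw_angle (R : realType) (s u : R) :
  continuous (iw_angle s u).
Proof.
move=> t; apply: differentiable_continuous.
exact: (@differentiable_iw_angle R _ (cst s) (cst u) id).
Qed.

Lemma mulGA (R : realType) : associative (@mulG R).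
Proof.
move=> x y z.
pose lhs t : R := mulG x (mulG y (pt t (z 0 1) (z 0 2))) 0 0.
pose rhs t : R := mulG (mulG x y) (pt t (z 0 1) (z 0 2)) 0 0.
have eqM t : covering (mulG x (mulG y (pt t (z 0 1) (z 0 2)))) =
    covering (mulG (mulG x y) (pt t (z 0 1) (z 0 2))).
  by rewrite !coveringM mulmxA.
suff e : lhs (z 0 0) = rhs (z 0 0).
  move: e (eqM (z 0 0)); rewrite /lhs /rhs -eq_pt => e /covering_fiber[k ek].
  move/eqP: e; rewrite ek [(_ + pt _ _ _) 0 0]mxE [pt (k%:~R * _) _ _ 0 0]ptE -subr_eq0 addrAC subrr.
  rewrite add0r => /eqP h.
  by rewrite h pt0 addr0.
pose D t := lhs t - rhs t.
have cD t : cos (D t) = 1.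
  have /covering_fiber[k ek] := eqM t.
  rewrite /D /lhs /rhs ek [(_ + pt _ _ _) 0 0]mxE [pt (k%:~R * _) _ _ 0 0]ptE addrAC subrr.
  by case: (cos_sin_period (0 : R) k) => -> _; rewrite cos0.
have D0 : D 0 = 0.
  by rewrite /D /lhs /rhs /mulG !ptE !iw_angle0 !addr0 subrr.
have contD : continuous D.
  move=> t; apply: differentiable_continuous.
  have dp : differentiable (fun t => pt t (z 0 1) (z 0 2)) t.
    exact: (@differentiable_pt R _ id (cst (z 0 1)) (cst (z 0 2))).
  have dcoord (f : R -> 'rV[R]_3) :
      differentiable f t -> differentiable (fun t => f t 0 0) t.
    move=> df.
    apply: (@differentiable_comp R _ _ _ f (fun M : 'rV[R]_3 => M 0 0)) => //.
    exact: differentiable_coord.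
  apply: differentiableB; apply: dcoord.
    apply: (@differentiable_mulG R _ (cst x)) => //.
    exact: (@differentiable_mulG R _ (cst y)).
  exact: (@differentiable_mulG R _ (cst (mulG x y))).
have IVT' (f : R -> R) a b v : a <= b -> continuous f ->
    Num.min (f a) (f b) <= v <= Num.max (f a) (f b) -> exists c, f c = v.
  move=> ab cf fv; have [|c _ <-] := @IVT R f a b v ab _ fv; last by exists c.
  exact: continuous_subspaceT.
have p0 := pi_gt0 R.
suff : D (z 0 0) = 0 by move/eqP; rewrite subr_eq0 => /eqP.
apply/eqP; apply/negPn/negP => Dn.
have [k ek] := cos_eq1 (cD (z 0 0)).
have kn : k != 0 by apply: contraNneq Dn => k0; rewrite ek k0 mul0r.
have big : pi <= `|D (z 0 0)|.
  rewrite ek normrM (gtr0_norm (_ : 0 < pi *+ 2)); last by rewrite pmulrn_lgt0.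
  have : 1 <= `|k%:~R : R| by rewrite norm_intr_ge1 ?intr_int ?intr_eq0.
  nra.
have [c hc] : exists c, D c = pi \/ D c = - pi.
  have [Dp|Dm] := leP 0 (D (z 0 0)).
    rewrite ger0_norm // in big.
    have [z0|z0] := leP 0 (z 0 0).
      have [|c hc] := IVT' D 0 (z 0 0) pi z0 contD; last by exists c; left.
      by rewrite D0 ge_min le_max big (ltW p0) orbT.
    have [|c hc] := IVT' D (z 0 0) 0 pi (ltW z0) contD; last by exists c; left.
    by rewrite D0 ge_min le_max big (ltW p0) !orbT.
  rewrite ltr0_norm // in big.
  have h1 : D (z 0 0) <= - pi by lra.
  have h2 : - pi <= 0 :> R by lra.
  have [z0|z0] := leP 0 (z 0 0).
    have [|c hc] := IVT' D 0 (z 0 0) (- pi) z0 contD; last by exists c; right.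
    by rewrite D0 ge_min le_max h1 h2 !orbT.
  have [|c hc] := IVT' D (z 0 0) 0 (- pi) (ltW z0) contD; last by exists c; right.
  by rewrite D0 ge_min le_max h1 h2 ?orbT.
have := cD c; have : cos (D c) = -1 by case: hc => ->; rewrite ?cosN cospi.
move=> ->; lra.
Qed.

Lemma mulGE (R : realType) (x y : 'rV[R]_3) : y 0 0 = 0 ->
  mulG x y = pt (x 0 0) (x 0 1 + y 0 1) (expR (- (2 * y 0 1)) * x 0 2 + y 0 2).
Proof.
move=> y0; rewrite /mulG y0 iw_angle0 addr0.
have E0 := expR_gt0 (x 0 1).
have -> : iw_norm (x 0 1) (x 0 2) 0 = expR (x 0 1).
  rewrite /iw_norm midE !mx2E sin0 cos0 !mulr0 !addr0 mulr1 expr0n addr0.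
  by rewrite sqrtr_sqr gtr0_norm.
rewrite expRK /iw_shear iw_norm2 midE !mx2E sin0 cos0; congr pt; congr (_ * _ + _).
have En : expR (x 0 1) != 0 by rewrite gt_eqF.
rewrite !(mulr0, mulr1, mul0r, addr0, subr0, expr0n) /=.
by field.
Qed.

Lemma mulG1 (R : realType) : right_id 0 (@mulG R).
Proof.
move=> x; rewrite mulGE !mxE //.
by rewrite mulr0 oppr0 expR0 mul1r !addr0 -eq_pt.
Qed.

Lemma mul_rot (R : realType) (a : R) (y : 'rV[R]_3) :
  mulG (pt a 0 0) y = pt (a + y 0 0) (y 0 1) (y 0 2).
Proof.
have hm : mid 0 0 (y 0 0) = rotmx (y 0 0).
  by rewrite midE /rotmx oppr0 expR0 !mul1r !mul0r addr0 sub0r.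
have hn : iw_norm 0 0 (y 0 0) = 1.
  by rewrite /iw_norm hm !mx2E cos2Dsin2 sqrtr1.
rewrite /mulG !ptE hn ln1 add0r; congr pt.
- by rewrite /iw_angle hm !mx2E [sin _ * cos _]mulrC subrr mul0r atan0 mulr0 addr0.
- by rewrite /iw_shear hm !mx2E mulrN [cos _ * sin _]mulrC addNr mul0r mulr0 add0r.
Qed.

Lemma mul1G (R : realType) : left_id 0 (@mulG R).
Proof. by move=> x; rewrite -pt0 mul_rot add0r -eq_pt. Qed.

Lemma mulVG (R : realType) : left_inverse 0 (@invG R) (@mulG R).
Proof.
move=> x; rewrite /invG -mulGA mul_rot addNr mulGE ?ptE // addNr.
by rewrite mulrN mulrA -expRD addNr expR0 mul1r addNr pt0.
Qed.

Lemma mulGV (R : realType) : right_inverse 0 (@invG R) (@mulG R).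
Proof.
move=> x; rewrite -[LHS]mul1G -{1}(mulVG (invG x)) -mulGA.
by rewrite [X in mulG _ X]mulGA mulVG mul1G mulVG.
Qed.

Lemma mx2D (R : realType) (a b c d a' b' c' d' : R) :
  mx2 a b c d + mx2 a' b' c' d' = mx2 (a + a') (b + b') (c + c') (d + d').
Proof. by rewrite [LHS]eq_mx2 !mxE. Qed.

Lemma mx2Z (R : realType) (k a b c d : R) :
  k *: mx2 a b c d = mx2 (k * a) (k * b) (k * c) (k * d).
Proof. by rewrite [LHS]eq_mx2 !mxE. Qed.

Lemma mx2B (R : realType) (a b c d a' b' c' d' : R) :
  mx2 a b c d - mx2 a' b' c' d' = mx2 (a - a') (b - b') (c - c') (d - d').
Proof. by rewrite [LHS]eq_mx2 !mxE. Qed.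

Lemma tr_mx2 (R : realType) (a b c d : R) : \tr (mx2 a b c d) = a + d.
Proof. by rewrite /mxtrace !big_ord_recl big_ord0 !mxE /= addr0. Qed.

Lemma sl2_comb (R : realType) (k : 'I_3 -> R) :
  \sum_(i < 3) k i *: (sl2_basis R)`_i = mx2 (k 0) (k 1) (k 2) (- k 0).
Proof.
rewrite !big_ord_recl big_ord0 /= !mx2Z addr0 !mx2D.
have -> : lift ord0 ord0 = 1 :> 'I_3 by exact: val_inj.
have -> : lift ord0 (lift ord0 ord0) = 2 :> 'I_3 by exact: val_inj.
by congr mx2; rewrite !(mulr0, mulr1, addr0, add0r) ?mulrN1.
Qed.

Lemma sl2_basis_free (R : realType) : free (sl2_basis R).
Proof.
apply/freeP => k; rewrite sl2_comb => e.
have e00 := congr1 (fun A : 'M[R]_2 => A 0 0) e.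
have e01 := congr1 (fun A : 'M[R]_2 => A 0 1) e.
have e10 := congr1 (fun A : 'M[R]_2 => A 1 0) e.
rewrite /= !mxE /= in e00 e01 e10.
case=> [[|[|[|//]]] p].
- by rewrite -e00; congr (k _); exact: val_inj.
- by rewrite -e01; congr (k _); exact: val_inj.
- by rewrite -e10; congr (k _); exact: val_inj.
Qed.

Lemma sl2_basis_span (R : realType) (X : 'M[R]_2) :
  (X \in <<sl2_basis R>>%VS) = (\tr X == 0).
Proof.
apply/idP/eqP => [/coord_span ->|].
  by rewrite (sl2_comb (fun i => coord (sl2_basis R) i X)) tr_mx2 subrr.
rewrite [X]eq_mx2 tr_mx2 => /eqP; rewrite addrC addr_eq0 => /eqP ->.
pose k (i : 'I_3) : R := [:: X 0 0; X 0 1; X 1 0]`_i.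
rewrite -[X in X \in _](sl2_comb k); apply: rpred_sum => i _.
by apply: rpredZ; apply: memv_span; apply: mem_nth.
Qed.

Lemma coord_sl2_basis (R : realType) (a b c : R) (i : 'I_3) :
  coord (sl2_basis R) i (mx2 a b c (- a)) = [:: a; b; c]`_i.
Proof.
rewrite -(sl2_comb (fun i => [:: a; b; c]`_i)) coord_sum_free //.
exact: sl2_basis_free.
Qed.

Lemma killingE (R : realType) (X Y : 'M[R]_2) : \tr X = 0 -> \tr Y = 0 ->
  killing X Y = 4 * \tr (X *m Y).
Proof.
rewrite [X]eq_mx2 [Y]eq_mx2 !tr_mx2.
set a := X 0 0; set b := X 0 1; set c := X 1 0.
set a' := Y 0 0; set b' := Y 0 1; set c' := Y 1 0.
move=> /eqP; rewrite addrC addr_eq0 => /eqP ->.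
move=> /eqP; rewrite addrC addr_eq0 => /eqP ->.
have cE p q r s i : s = - p ->
    coord (sl2_basis R) i (mx2 p q r s) = [:: p; q; r]`_i.
  by move=> ->; exact: coord_sl2_basis.
rewrite /killing /lie !big_ord_recl big_ord0 /= !mx2M !mx2B !mx2M !mx2B tr_mx2.
by rewrite !cE /=; ring.
Qed.

(* Main.v *)
Require Import Defs.
From mathcomp Require Import all_boot all_order all_algebra ring lra.
From mathcomp Require Import all_classical all_reals all_analysis.

Set Implicit Arguments.
Unset Strict Implicit.
Unset Printing Implicit Defensive.

Import Order.TTheory GRing.Theory Num.Theory.
Import numFieldNormedType.Exports.
Local Open Scope ring_scope.

(** A left-invariant metric is determined by its Gram matrix G at the unit.  Since
    sl(2,R) is unimodular, its bracket is [x, y] = L (x `x` y), where `x` is the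
    cross product of the metric and L is self-adjoint.  With
    M = tr L / 2 - L, the Levi-Civita connection is D_x y = M x `x` y on
    left-invariant fields, and the Cayley-Hamilton theorem turns the curvature
    into
      R(x, y) z = (2 adj M - tr (adj M)) (x `x` y) `x` z.
    Constant curvature K says that 2 adj M - tr (adj M) is a multiple of the
    identity by K up to sign; taking traces, so is adj M.  As K != 0 and
    M (adj M) = det M, the operator M is scalar, hence so is L.  Then
    <[x, y], z> is a multiple of the volume form: G is proportional to the
    inverse of the symmetric tensor N of the bracket, which is the Killing form
    up to a factor.

    The computation is done in the Iwasawa chart.  The rows of [coframe] express
    the coordinate fields in the left-invariant frame, so that
    h x = C(x) G C(x)^T ([left_invariant_mx]); this gives the 2-jet of h at the
    unit, and with it the lowered Riemann tensor ([riemann_lowE],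
    [det_riemann_low]) as a polynomial in G after multiplication by det G.
    Constant sectional curvature is known on nondegenerate planes only, and is
    extended to all planes by a polynomial argument ([quartic_vanish]).  The
    formula above for R is [curv_mx] together with the lemmas [jacobi_sum_00] to
    [jacobi_sum_12], and [curv_mx_killing] is the linear algebra that ends the
    argument.  Right invariance follows, because the Killing metric is right
    invariant: right translations act on sl(2,R) by conjugation, which preserves
    the trace form ([killing_metric_right_invariant]). *)

(** * Derivatives of scalar and matrix functions *)

Lemma differentiable_sum_fun (R : realType) (V : normedModType R) (I : Type)
    (r : seq I) (f : I -> V -> R) (x : V) :
  (forall i, differentiable (f i) x) ->
  differentiable (fun y => \sum_(i <- r) f i y) x.
Proof.
move=> df; elim: r => [|i r IHr].
  by under eq_fun do rewrite big_nil; exact: differentiable_cst.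
by under eq_fun do rewrite big_cons; exact: differentiableD.
Qed.

Lemma differentiable_prod_fun (R : realType) (V : normedModType R) (I : Type)
    (r : seq I) (f : I -> V -> R) (x : V) :
  (forall i, differentiable (f i) x) ->
  differentiable (fun y => \prod_(i <- r) f i y) x.
Proof.
move=> df; elim: r => [|i r IHr].
  by under eq_fun do rewrite big_nil; exact: differentiable_cst.
by under eq_fun do rewrite big_cons; exact: differentiableM.
Qed.

Lemma differentiable_det (R : realType) (V : normedModType R) (n : nat)
    (A : V -> 'M[R]_n) (x : V) :
  (forall i j, differentiable (fun y => A y i j) x) ->
  differentiable (fun y => \det (A y)) x.
Proof.
move=> dA; apply: differentiable_sum_fun => s.
apply: differentiableM; first exact: differentiable_cst.
exact: differentiable_prod_fun.
Qed.

(** By Cramer's rule the entries are quotients of polynomials. *)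
Lemma differentiable_invmx (R : realType) (V : normedModType R) (n : nat)
    (A : V -> 'M[R]_n) (x : V) (i j : 'I_n) :
  (forall y, A y \in unitmx) ->
  (forall i j, differentiable (fun y => A y i j) x) ->
  differentiable (fun y => invmx (A y) i j) x.
Proof.
move=> uA dA.
under eq_fun do rewrite /invmx uA mxE mxE.
apply: differentiableM.
  apply: differentiableV; first exact: differentiable_det.
  by rewrite -unitfE -unitmxE.
apply: differentiableM; first exact: differentiable_cst.
by apply: differentiable_det => k l; under eq_fun do rewrite !mxE.
Qed.

Lemma is_derive_mul (R : realType) (V : normedModType R) (f g : V -> R) x v a b :
  is_derive x v f a -> is_derive x v g b ->
  is_derive x v (fun y => f y * g y) (a * g x + f x * b).
Proof.
move=> df dg; rewrite addrC [a * _]mulrC; exact: is_deriveM.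
Qed.

Lemma is_derive_add (R : realType) (V : normedModType R) (f g : V -> R) x v a b :
  is_derive x v f a -> is_derive x v g b ->
  is_derive x v (fun y => f y + g y) (a + b).
Proof. by move=> df dg; exact: is_deriveD. Qed.

Lemma is_derive_sub (R : realType) (V : normedModType R) (f g : V -> R) x v a b :
  is_derive x v f a -> is_derive x v g b ->
  is_derive x v (fun y => f y - g y) (a - b).
Proof. by move=> df dg; exact: is_deriveB. Qed.

Lemma is_derive_sum_fun (R : realType) (V : normedModType R) (I : Type)
    (r : seq I) (f : I -> V -> R) df x v :
  (forall i, is_derive x v (f i) (df i)) ->
  is_derive x v (fun y => \sum_(i <- r) f i y) (\sum_(i <- r) df i).
Proof.
move=> hf; elim: r => [|i r IHr].
  by under eq_fun do rewrite big_nil; rewrite big_nil; exact: is_derive_cst.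
by under eq_fun do rewrite big_cons; rewrite big_cons; exact: is_deriveD.
Qed.

(** A directional derivative is an ordinary derivative along a line, which makes
    the chain rule of one real variable available. *)
Lemma is_derive_line (R : realType) (V : normedModType R) (f : V -> R) x v df :
  is_derive (0 : R) 1 (fun t : R => f (t *: v + x)) df <-> is_derive x v f df.
Proof.
have e : (fun h : R => h^-1 *: (((fun t : R => f (t *: v + x)) \o shift 0) (h *: 1)
      - f (0 *: v + x))) = (fun h => h^-1 *: ((f \o shift x) (h *: v) - f x)).
  by apply/funext => h /=; rewrite !addr0 scale0r add0r [h *: 1]mulr1.
split=> -[d1 d2]; split.
- by move: d1; rewrite /derivable e.
- by rewrite -d2 /derive e.
- by rewrite /derivable e.
- by rewrite -d2 /derive e.
Qed.

Lemma is_derive_comp_scalar (R : realType) (V : normedModType R) (f : R -> R)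
    (g : V -> R) x v a b :
  is_derive (g x) 1 f a -> is_derive x v g b ->
  is_derive x v (fun y => f (g y)) (b * a).
Proof.
move=> df dg; apply/is_derive_line; rewrite mulrC.
apply: (@is_derive1_comp R f (fun t : R => g (t *: v + x))).
  by rewrite scale0r add0r.
exact/is_derive_line.
Qed.

Lemma is_derive_coord (R : realType) m n (x v : 'M[R]_(m, n)) i j :
  is_derive x v (fun y : 'M[R]_(m, n) => y i j) (v i j).
Proof.
have dx : derivable (fun y : 'M[R]_(m, n) => y) x v by exact: derivable_id.
split; first by move/derivable_mxP: dx; apply.
by have /matrixP/(_ i j) := derive_mx dx; rewrite mxE derive_id.
Qed.

Lemma diff_mxE (R : realType) (V : normedModType R) m n (f : V -> 'M[R]_(m, n))
    x v i j :
  differentiable f x -> 'd f x v i j = 'D_v (fun y => f y i j) x.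
Proof.
move=> df; rewrite -deriveE // derive_mx ?mxE //; exact: diff_derivable.
Qed.

Lemma is_derive_mxE (R : realType) (V : normedModType R) m n (f : V -> 'M[R]_(m, n))
    x v i j :
  differentiable f x -> is_derive x v (fun y => f y i j) ('d f x v i j).
Proof.
move=> df; have /derivable_mxP/(_ i j) d : derivable f x v by exact: diff_derivable.
by split=> //; rewrite diff_mxE.
Qed.

Lemma diff_compE (R : numFieldType) (U V W : normedModType R) (f : U -> V)
    (g : V -> W) x v :
  differentiable f x -> differentiable g (f x) ->
  'd (g \o f) x v = 'd g (f x) ('d f x v).
Proof. by move=> df dg; rewrite diff_comp. Qed.

Definition is_mx_derive (R : realType) (V : normedModType R) m n
    (A : V -> 'M[R]_(m, n)) (x v : V) (dA : 'M[R]_(m, n)) : Prop :=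
  forall i j, is_derive x v (fun y => A y i j) (dA i j).

Lemma is_mx_deriveM (R : realType) (V : normedModType R) m n p
    (A : V -> 'M[R]_(m, n)) (B : V -> 'M[R]_(n, p)) x v dA dB :
  is_mx_derive A x v dA -> is_mx_derive B x v dB ->
  is_mx_derive (fun y => A y *m B y) x v (dA *m B x + A x *m dB).
Proof.
move=> hA hB i j; rewrite !mxE -big_split /=.
have -> : (fun y => (A y *m B y) i j) = (fun y => \sum_k A y i k * B y k j).
  by apply/funext => y; rewrite mxE.
by apply: is_derive_sum_fun => k; exact: is_derive_mul.
Qed.

Lemma is_mx_deriveD (R : realType) (V : normedModType R) m n
    (A B : V -> 'M[R]_(m, n)) x v dA dB :
  is_mx_derive A x v dA -> is_mx_derive B x v dB ->
  is_mx_derive (fun y => A y + B y) x v (dA + dB).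
Proof.
move=> hA hB i j; rewrite !mxE.
have -> : (fun y => (A y + B y) i j) = (fun y => A y i j + B y i j).
  by apply/funext => y; rewrite mxE.
exact: is_derive_add.
Qed.

Lemma is_mx_derive_cst (R : realType) (V : normedModType R) m n
    (A : 'M[R]_(m, n)) (x v : V) : is_mx_derive (fun=> A) x v 0.
Proof. by move=> i j; rewrite mxE; exact: is_derive_cst. Qed.

Lemma is_mx_derive_tr (R : realType) (V : normedModType R) m n
    (A : V -> 'M[R]_(m, n)) (x v : V) dA :
  is_mx_derive A x v dA -> is_mx_derive (fun y => (A y)^T) x v dA^T.
Proof.
move=> hA i j; rewrite mxE.
have -> : (fun y => (A y)^T i j) = (fun y => A y j i).
  by apply/funext => y; rewrite mxE.
exact: hA.
Qed.

Lemma is_mx_derive_congr (R : realType) (V : normedModType R) n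
    (A B : V -> 'M[R]_n) (G : 'M[R]_n) (x v : V) dA dB :
  is_mx_derive A x v dA -> is_mx_derive B x v dB ->
  is_mx_derive (fun y => A y *m G *m (B y)^T) x v
    (dA *m G *m (B x)^T + A x *m G *m dB^T).
Proof.
move=> hA hB; have := is_mx_deriveM
  (is_mx_deriveM hA (is_mx_derive_cst G x v)) (is_mx_derive_tr hB).
by rewrite mulmx0 addr0.
Qed.

(** * The Riemann tensor with all indices lowered *)

(** Christoffel symbols of the first kind. *)
Definition christoffel1 (R : realType) (g : 'rV[R]_3 -> 'M[R]_3)
    (l i j : 'I_3) (x : 'rV[R]_3) : R :=
  2^-1 * (partial i (fun y => g y j l) x + partial j (fun y => g y i l) x
          - partial l (fun y => g y i j) x).

(** The component <R(d_i, d_j) d_k, d_m>. *)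
Definition riemann_low (R : realType) (g : 'rV[R]_3 -> 'M[R]_3)
    (m k i j : 'I_3) (x : 'rV[R]_3) : R :=
  \sum_(l < 3) g x m l * riemann g l k i j x.

Lemma is_derive_partial (R : realType) (f : 'rV[R]_3 -> R) x i :
  differentiable f x -> is_derive x (delta_mx 0 i) f (partial i f x).
Proof. by move=> df; apply/derivableP/diff_derivable. Qed.

Section Smooth.
Variables (R : realType) (g : 'rV[R]_3 -> 'M[R]_3).
Hypothesis g_smooth : forall i j, smooth (fun x => g x i j).
Hypothesis g_sym : forall x, (g x)^T = g x.
Hypothesis g_unit : forall x, g x \in unitmx.

Let gC x i j : g x i j = g x j i.
Proof. by rewrite -[in LHS](g_sym x) mxE. Qed.

Let dg i j x : differentiable (fun y => g y i j) x.
Proof. exact: (g_smooth i j [::]). Qed.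

Let dpg k i j x : differentiable (partial k (fun y => g y i j)) x.
Proof. exact: (g_smooth i j [:: k]). Qed.

Let pgC k i j x : partial k (fun y => g y i j) x = partial k (fun y => g y j i) x.
Proof. by congr (partial k _ x); apply/funext => y; exact: gC. Qed.

Lemma christoffelE k i j x :
  christoffel g k i j x = \sum_(l < 3) invmx (g x) k l * christoffel1 g l i j x.
Proof.
rewrite /christoffel mulr_sumr; apply: eq_bigr => l _.
by rewrite /christoffel1 mulrCA.
Qed.

Lemma christoffel_lower m i j x :
  \sum_(k < 3) g x m k * christoffel g k i j x = christoffel1 g m i j x.
Proof.
pose c := \col_l christoffel1 g l i j x.
have := mulmxV (g_unit x) => /(congr1 (fun A => (A *m c) m 0)).
rewrite mul1mx [RHS]mxE => <-; rewrite -mulmxA mxE.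
apply: eq_bigr => k _; congr (_ * _); rewrite christoffelE mxE.
by apply: eq_bigr => l _; rewrite [c _ _]mxE.
Qed.

Lemma differentiable_christoffel1 l i j x :
  differentiable (christoffel1 g l i j) x.
Proof.
apply: differentiableM; first exact: differentiable_cst.
by apply: differentiableB => //; apply: differentiableD.
Qed.

Lemma differentiable_christoffel k i j x : differentiable (christoffel g k i j) x.
Proof.
have -> : christoffel g k i j =
    (fun y => \sum_(l < 3) invmx (g y) k l * christoffel1 g l i j y).
  by apply/funext => y; exact: christoffelE.
apply: differentiable_sum_fun => l; apply: differentiableM.
  exact: differentiable_invmx.
exact: differentiable_christoffel1.
Qed.

(** That is, the Levi-Civita connection preserves the metric. *)
Lemma partial_metric i m l x :
  partial i (fun y => g y m l) x = christoffel1 g m i l x + christoffel1 g l i m x.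
Proof.
rewrite /christoffel1 (pgC i l m).
move: (partial _ _ _) (partial _ _ _) (partial _ _ _) => a b c; by field.
Qed.

(** Lowering an index does not commute with differentiation; the correction is the
    derivative of the metric. Differentiating [christoffel_lower] gives it
    without differentiating the inverse metric. *)
Lemma lower_partial_christoffel a m i j x :
  \sum_(k < 3) g x m k * partial a (christoffel g k i j) x =
  partial a (christoffel1 g m i j) x
  - (\sum_(k < 3) christoffel1 g m a k x * christoffel g k i j x
     + \sum_(k < 3) christoffel1 g k a m x * christoffel g k i j x).
Proof.
rewrite -big_split /=; under [X in _ - X]eq_bigr do rewrite -mulrDl -partial_metric.
apply/eqP; rewrite eq_sym subr_eq addrC -big_split /=; apply/eqP.
rewrite {1}/partial.
rewrite -[christoffel1 g m i j](_ :
  (fun y => \sum_(k < 3) g y m k * christoffel g k i j y) = _).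
  apply: derive_val; apply: is_derive_sum_fun => k.
  apply: is_derive_mul; apply: is_derive_partial => //.
  exact: differentiable_christoffel.
by apply/funext => y; exact: christoffel_lower.
Qed.

(** Only derivatives of symbols of the first kind remain, so the value at a point
    is read off from the 2-jet of the metric there. *)
Lemma riemann_lowE m k i j x :
  riemann_low g m k i j x =
  partial i (christoffel1 g m j k) x - partial j (christoffel1 g m i k) x
  - \sum_(l < 3) christoffel1 g l i m x * christoffel g l j k x
  + \sum_(l < 3) christoffel1 g l j m x * christoffel g l i k x.
Proof.
pose quad l := \sum_(p < 3) (christoffel g l i p x * christoffel g p j k x
                          - christoffel g l j p x * christoffel g p i k x).
have -> : riemann_low g m k i j x =
    \sum_(l < 3) g x m l * partial i (christoffel g l j k) x
    - \sum_(l < 3) g x m l * partial j (christoffel g l i k) x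
    + \sum_(l < 3) g x m l * quad l.
  rewrite -sumrB -big_split /=; apply: eq_bigr => l _.
  by rewrite -mulrBr -mulrDr.
have e : \sum_(l < 3) g x m l * quad l =
    \sum_(p < 3) christoffel1 g m i p x * christoffel g p j k x
    - \sum_(p < 3) christoffel1 g m j p x * christoffel g p i k x.
  under eq_bigr do rewrite mulr_sumr.
  rewrite exchange_big -sumrB /=; apply: eq_bigr => p _.
  rewrite -(christoffel_lower m i p x) -(christoffel_lower m j p x) !mulr_suml -sumrB.
  by apply: eq_bigr => l _; rewrite mulrBr !mulrA.
etransitivity.
  apply: f_equal2 e; apply: f_equal2; last apply: f_equal;
    exact: lower_partial_christoffel.
have arith (P Q a b c d : R) : P - (a + b) - (Q - (c + d)) + (a - c) = P - Q - b + d.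
  by ring.
exact: arith.
Qed.
End Smooth.

(** * Constant sectional curvature as a polynomial identity *)

Lemma poly_eq0_horner (R : numDomainType) (p : {poly R}) :
  (forall t, p.[t] = 0) -> p = 0.
Proof.
move=> p0; apply/eqP/negPn/negP => pN0.
pose s : seq R := [seq i%:R | i <- iota 0 (size p)].
have us : uniq s.
  by rewrite map_inj_uniq ?iota_uniq // => i j /eqP; rewrite eqr_nat => /eqP.
have rs : all (root p) s by apply/allP => t _; rewrite rootE p0.
by have := max_poly_roots pN0 rs us; rewrite size_map size_iota ltnn.
Qed.

(** The coefficients are taken in an arbitrary commutative ring, so that the form
    can also be evaluated at vectors with polynomial entries. *)
Definition quartic_form (A : comPzRingType) (T : 'I_3 -> 'I_3 -> 'I_3 -> 'I_3 -> A)
    (v w : 'rV[A]_3) : A :=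
  \sum_(m < 3) \sum_(i < 3) \sum_(j < 3) \sum_(k < 3)
    T m i j k * (v 0 m * v 0 i * w 0 j * w 0 k).

(** On the line from (v0, w0) to (v, w) the two forms are polynomials in one
    variable whose product vanishes everywhere, and the first of them is not
    zero. *)
Lemma quartic_vanish (R : numDomainType) (S T : 'I_3 -> 'I_3 -> 'I_3 -> 'I_3 -> R)
    (v0 w0 v w : 'rV[R]_3) :
  (forall v w, quartic_form S v w != 0 -> quartic_form T v w = 0) ->
  quartic_form S v0 w0 != 0 -> quartic_form T v w = 0.
Proof.
move=> ST S0.
pose line (a b : 'rV[R]_3) : 'rV[{poly R}]_3 :=
  \row_i ((a 0 i)%:P + 'X * (b 0 i - a 0 i)%:P).
pose P (U : 'I_3 -> 'I_3 -> 'I_3 -> 'I_3 -> R) :=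
  quartic_form (fun m i j k => (U m i j k)%:P) (line v0 v) (line w0 w).
have PE U t : (P U).[t] = quartic_form U (v0 + t *: (v - v0)) (w0 + t *: (w - w0)).
  rewrite horner_sum; apply: eq_bigr => m _.
  rewrite horner_sum; apply: eq_bigr => i _.
  rewrite horner_sum; apply: eq_bigr => j _.
  rewrite horner_sum; apply: eq_bigr => k _.
  by rewrite !hornerM !mxE !hornerE.
have : P S * P T = 0.
  apply: poly_eq0_horner => t; rewrite hornerM !PE.
  have [->|/ST ->] := eqVneq (quartic_form S (v0 + t *: (v - v0)) (w0 + t *: (w - w0))) 0.
    by rewrite mul0r.
  by rewrite mulr0.
move/eqP; rewrite mulf_eq0 => /orP[]/eqP P0.
  have := PE S 0; rewrite P0 horner0 !scale0r !addr0 => e.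
  by rewrite -e eqxx in S0.
by have := PE T 1; rewrite P0 horner0 !scale1r !subrKC => <-.
Qed.

Lemma metric_ipE (R : realType) (g : 'rV[R]_3 -> 'M[R]_3) x v w :
  metric_ip g x v w = \sum_(i < 3) \sum_(j < 3) v 0 i * g x i j * w 0 j.
Proof.
rewrite /metric_ip mxE exchange_big /=; apply: eq_bigr => j _.
by rewrite !mxE mulr_suml.
Qed.

Lemma metric_ip_delta (R : realType) (g : 'rV[R]_3 -> 'M[R]_3) x i j :
  metric_ip g x (delta_mx 0 i) (delta_mx 0 j) = g x i j.
Proof. by rewrite /metric_ip trmx_delta -rowE -colE !mxE. Qed.

(** Evaluate at e_i + e_j. *)
Lemma metric_ip_alt (R : realType) (g : 'rV[R]_3 -> 'M[R]_3) x :
  (forall v, metric_ip g x v v = 0) -> forall i j, g x i j + g x j i = 0.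
Proof.
move=> g0 i j.
have Dl u v w : metric_ip g x (u + v) w = metric_ip g x u w + metric_ip g x v w.
  by rewrite /metric_ip !mulmxDl mxE.
have Dr u v w : metric_ip g x w (u + v) = metric_ip g x w u + metric_ip g x w v.
  by rewrite /metric_ip linearD mulmxDr mxE.
have := g0 (delta_mx 0 i + delta_mx 0 j).
by rewrite Dl !Dr !g0 add0r addr0 !metric_ip_delta.
Qed.

Section ConstantCurvature.
Variables (R : realType) (g : 'rV[R]_3 -> 'M[R]_3).

Lemma plane_discrE x v w : plane_discr g x v w =
  quartic_form (fun m i j k => g x m i * g x j k - g x m j * g x i k) v w.
Proof.
have mul_sum2 (F G : 'I_3 -> 'I_3 -> R) :
    (\sum_m \sum_i F m i) * (\sum_j \sum_k G j k) =
    \sum_m \sum_i \sum_j \sum_k F m i * G j k.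
  rewrite mulr_suml; apply: eq_bigr => m _.
  rewrite mulr_suml; apply: eq_bigr => i _.
  by rewrite mulr_sumr; apply: eq_bigr => j _; rewrite mulr_sumr.
rewrite /plane_discr expr2 !metric_ipE !mul_sum2 -sumrB.
apply: eq_bigr => m _; rewrite [X in _ - X]exchange_big -sumrB /=.
apply: eq_bigr => i _; rewrite -sumrB; apply: eq_bigr => j _.
rewrite -sumrB; apply: eq_bigr => k _; ring.
Qed.

Hypothesis g_sym : forall x, (g x)^T = g x.

Lemma curvature_quarticE x v w :
  metric_ip g x (curvature g x v w w) v =
  quartic_form (fun m i j k => riemann_low g m k i j x) v w.
Proof.
rewrite metric_ipE exchange_big /=; apply: eq_bigr => m _.
under eq_bigr do rewrite mxE mulr_suml mulr_suml.
rewrite exchange_big /=; apply: eq_bigr => i _.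
under eq_bigr do rewrite mulr_suml mulr_suml.
rewrite exchange_big /=; apply: eq_bigr => j _.
under eq_bigr do rewrite mulr_suml mulr_suml.
rewrite exchange_big /=; apply: eq_bigr => k _.
rewrite /riemann_low mulr_suml; apply: eq_bigr => l _.
by rewrite -[in LHS](g_sym x) mxE; ring.
Qed.

(** The identity <R(v, w) w, v> = K (<v, v> <w, w> - <v, w>^2) extends to the
    degenerate planes by [quartic_vanish]; it is then polarized in v, with
    w = d_j. *)
Lemma const_curvature_riemann_low (K : R) x (a b : 'rV[R]_3) j m i :
  constant_sectional_curvature g K -> plane_discr g x a b != 0 ->
  riemann_low g m j i j x + riemann_low g i j m j x =
  2 * K * (g x m i * g x j j - g x m j * g x i j).
Proof.
move=> gK ab0.
pose S m i j k := g x m i * g x j k - g x m j * g x i k.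
pose T m i j k := riemann_low g m k i j x - K * S m i j k.
have TE v w : quartic_form T v w =
    metric_ip g x (curvature g x v w w) v - K * plane_discr g x v w.
  rewrite curvature_quarticE plane_discrE /quartic_form.
  rewrite mulr_sumr -sumrB; apply: eq_bigr => m' _.
  rewrite mulr_sumr -sumrB; apply: eq_bigr => i' _.
  rewrite mulr_sumr -sumrB; apply: eq_bigr => j' _.
  rewrite mulr_sumr -sumrB; apply: eq_bigr => k' _.
  by rewrite /T mulrBl -(mulrA K).
have T0 v w : quartic_form T v w = 0.
  have SE v' w' : quartic_form S v' w' = plane_discr g x v' w' by rewrite plane_discrE.
  apply: (@quartic_vanish _ S T a b); last by rewrite SE.
  move=> v' w'; rewrite SE => D0.
  by rewrite TE -(gK x v' w' D0) /sectional_curvature divfK ?subrr.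
pose Q : 'M[R]_3 := \matrix_(m, i) T m i j j.
have Q0 v : metric_ip (fun=> Q) x v v = 0.
  rewrite metric_ipE -[RHS](T0 v (delta_mx 0 j)); apply: eq_bigr => m' _.
  apply: eq_bigr => i' _; rewrite (bigD1 j) //= (bigD1 j) //= !big1 ?addr0.
  - by rewrite !mxE !eqxx !mulr1 [RHS]mulrA [v 0 m' * _]mulrC.
  - move=> j' /negPf nj; rewrite big1 // => k' _.
    by rewrite !mxE !eqxx nj !(mulr0, mul0r).
  - by move=> k' /negPf nk; rewrite !mxE !eqxx nk !mulr0.
have := metric_ip_alt Q0 m i; rewrite !mxE /T /S => /eqP.
rewrite addrACA addr_eq0 opprD !opprK => /eqP ->.
have -> : g x i m = g x m i by rewrite -[in LHS](g_sym x) mxE.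
ring.
Qed.
End ConstantCurvature.

(** * Matrices of size 3 *)

Lemma sum3 (V : nmodType) (F : 'I_3 -> V) : \sum_i F i = F 0 + F 1 + F 2.
Proof.
rewrite !big_ord_recl big_ord0 addr0 addrA.
by congr (_ + F _ + F _); exact: val_inj.
Qed.

Definition mx3 (R : realType) (a b c d e f g h i : R) : 'M[R]_3 :=
  \matrix_(k, l) (nth [::] [:: [:: a; b; c]; [:: d; e; f]; [:: g; h; i]] k)`_l.

Lemma eq_mx3 (R : realType) (A : 'M[R]_3) :
  A = mx3 (A 0 0) (A 0 1) (A 0 2) (A 1 0) (A 1 1) (A 1 2) (A 2 0) (A 2 1) (A 2 2).
Proof.
apply/matrixP => i j; rewrite mxE.
by case: i => [[|[|[|//]]] p]; case: j => [[|[|[|//]]] q] /=;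
  congr (A _ _); apply: val_inj.
Qed.

Lemma mx3M (R : realType) (a b c d e f g h i a' b' c' d' e' f' g' h' i' : R) :
  mx3 a b c d e f g h i *m mx3 a' b' c' d' e' f' g' h' i' =
  mx3 (a * a' + b * d' + c * g') (a * b' + b * e' + c * h') (a * c' + b * f' + c * i')
      (d * a' + e * d' + f * g') (d * b' + e * e' + f * h') (d * c' + e * f' + f * i')
      (g * a' + h * d' + i * g') (g * b' + h * e' + i * h') (g * c' + h * f' + i * i').
Proof. by rewrite [LHS]eq_mx3 !mxE !sum3 !mxE. Qed.

Lemma mx3D (R : realType) (a b c d e f g h i a' b' c' d' e' f' g' h' i' : R) :
  mx3 a b c d e f g h i + mx3 a' b' c' d' e' f' g' h' i' =
  mx3 (a + a') (b + b') (c + c') (d + d') (e + e') (f + f') (g + g') (h + h') (i + i').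
Proof. by rewrite [LHS]eq_mx3 !mxE. Qed.

Lemma mx3Z (R : realType) (k a b c d e f g h i : R) :
  k *: mx3 a b c d e f g h i =
  mx3 (k * a) (k * b) (k * c) (k * d) (k * e) (k * f) (k * g) (k * h) (k * i).
Proof. by rewrite [LHS]eq_mx3 !mxE. Qed.

Lemma mx3N (R : realType) (a b c d e f g h i : R) :
  - mx3 a b c d e f g h i =
  mx3 (- a) (- b) (- c) (- d) (- e) (- f) (- g) (- h) (- i).
Proof. by rewrite [LHS]eq_mx3 !mxE. Qed.

Lemma trmx_mx3 (R : realType) (a b c d e f g h i : R) :
  (mx3 a b c d e f g h i)^T = mx3 a d g b e h c f i.
Proof. by rewrite [LHS]eq_mx3 !mxE. Qed.

Lemma scalar_mx3 (R : realType) (k : R) : k%:M = mx3 k 0 0 0 k 0 0 0 k.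
Proof. by rewrite [LHS]eq_mx3 !mxE. Qed.

Lemma mxtrace_mx3 (R : realType) (a b c d e f g h i : R) :
  \tr (mx3 a b c d e f g h i) = a + e + i.
Proof. by rewrite /mxtrace sum3 !mxE. Qed.

Lemma det_mx3 (R : realType) (a b c d e f g h i : R) :
  \det (mx3 a b c d e f g h i) =
  a * (e * i - f * h) - b * (d * i - f * g) + c * (d * h - e * g).
Proof.
rewrite (expand_det_row _ 0) sum3 /cofactor.
rewrite !(expand_det_row _ 0) !big_ord_recl !big_ord0 /cofactor !det_mx11 !mxE /=.
rewrite /bump /=. ring.
Qed.

Lemma adj_mx3 (R : realType) (a b c d e f g h i : R) :
  \adj (mx3 a b c d e f g h i) =
  mx3 (e * i - f * h) (c * h - b * i) (b * f - c * e)
      (f * g - d * i) (a * i - c * g) (c * d - a * f)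
      (d * h - e * g) (b * g - a * h) (a * e - b * d).
Proof.
rewrite [LHS]eq_mx3 !mxE /cofactor.
rewrite !(expand_det_row _ 0) !big_ord_recl !big_ord0 /cofactor !det_mx11 !mxE /=.
rewrite /bump /=; congr mx3; ring.
Qed.

Lemma is_mx_derive_mx3 (R : realType) (V : normedModType R)
    (a b c d e f g h k : V -> R) (x v : V) da db dc dd de df dg dh dk :
  is_derive x v a da -> is_derive x v b db -> is_derive x v c dc ->
  is_derive x v d dd -> is_derive x v e de -> is_derive x v f df ->
  is_derive x v g dg -> is_derive x v h dh -> is_derive x v k dk ->
  is_mx_derive (fun y => mx3 (a y) (b y) (c y) (d y) (e y) (f y) (g y) (h y) (k y))
    x v (mx3 da db dc dd de df dg dh dk).
Proof.
move=> ? ? ? ? ? ? ? ? ? i j; rewrite mxE.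
have -> : (fun y => mx3 (a y) (b y) (c y) (d y) (e y) (f y) (g y) (h y) (k y) i j) =
    (fun y => (nth [::] [:: [:: a; b; c]; [:: d; e; f]; [:: g; h; k]] i)`_j y).
  apply/funext => y; rewrite mxE.
  by case: i => [[|[|[|//]]] ?]; case: j => [[|[|[|//]]] ?].
by case: i => [[|[|[|//]]] ?]; case: j => [[|[|[|//]]] ?].
Qed.

(** * The left-invariant coframe *)

(** Row i holds the coordinates of covering(x)^-1 d_i covering(x) in the basis
    (J, H, E) of sl(2,R), where J = F - E generates the rotations and H, E
    generate the other two Iwasawa factors.  Explicitly, with p = e^(2s),
    N(-u) A(-s) J A(s) N(u) = p (F - u H - u^2 E) - E / p and
    N(-u) H N(u) = H + 2 u E. *)
Definition coframe (R : realType) (x : 'rV[R]_3) : 'M[R]_3 :=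
  let p := expR (2 * x 0 1) in let q := expR (- 2 * x 0 1) in let u := x 0 2 in
  mx3 p (- (p * u)) (p - q - p * u ^+ 2)
      0 1 (2 * u)
      0 0 1.

(** The element w_0 J + w_1 H + w_2 E. *)
Definition sl2_of (R : realType) (w : 'rV[R]_3) : 'M[R]_2 :=
  mx2 (w 0 1) (w 0 2 - w 0 0) (w 0 0) (- w 0 1).

Lemma coveringE (R : realType) (x : 'rV[R]_3) :
  covering x = mx2 (cos (x 0 0) * expR (x 0 1))
    (cos (x 0 0) * expR (x 0 1) * x 0 2 - sin (x 0 0) * expR (- x 0 1))
    (sin (x 0 0) * expR (x 0 1))
    (sin (x 0 0) * expR (x 0 1) * x 0 2 + cos (x 0 0) * expR (- x 0 1)).
Proof. by rewrite /covering /rotmx /dilmx /shearmx !mx2M; congr mx2; ring. Qed.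

Lemma coframe0 (R : realType) : coframe (0 : 'rV[R]_3) = 1%:M.
Proof.
apply/matrixP => i j; rewrite /coframe !mxE !mulr0 expR0 expr0n !(mulr0, subr0, subrr, oppr0).
by case: i => [[|[|[|//]]] ?]; case: j => [[|[|[|//]]] ?].
Qed.

Lemma sl2_of_inj (R : realType) : injective (@sl2_of R).
Proof.
move=> v w /matrixP e; have e00 := e 0 0; have e01 := e 0 1; have e10 := e 1 0.
rewrite /sl2_of !mx2E in e00 e01 e10.
rewrite [v]eq_pt [w]eq_pt e00 e10; congr pt.
by apply: (addIr (- v 0 0)); rewrite e01 e10.
Qed.

Lemma mxtrace_sl2_of (R : realType) (w : 'rV[R]_3) : \tr (sl2_of w) = 0.
Proof. by rewrite tr_mx2 subrr. Qed.

Lemma covering0 (R : realType) : covering (0 : 'rV[R]_3) = 1%:M.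
Proof.
rewrite coveringE !mxE sin0 cos0 oppr0 expR0 [RHS]eq_mx2 !mxE /=.
by congr mx2; ring.
Qed.

(** The Maurer-Cartan form of the covering map. *)
Lemma diff_covering (R : realType) (x v : 'rV[R]_3) :
  'd (@covering R) x v = covering x *m sl2_of (v *m coframe x).
Proof.
have dc := @differentiable_covering R x.
rewrite [LHS]eq_mx2 !(diff_mxE _ _ _ dc).
have D0 : is_derive x v (fun y : 'rV[R]_3 => y 0 0) (v 0 0) by exact: is_derive_coord.
have D1 : is_derive x v (fun y : 'rV[R]_3 => y 0 1) (v 0 1) by exact: is_derive_coord.
have D2 : is_derive x v (fun y : 'rV[R]_3 => y 0 2) (v 0 2) by exact: is_derive_coord.
have Dc : is_derive x v (fun y : 'rV[R]_3 => cos (y 0 0)) (v 0 0 * - sin (x 0 0)).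
  exact: is_derive_comp_scalar.
have Ds : is_derive x v (fun y : 'rV[R]_3 => sin (y 0 0)) (v 0 0 * cos (x 0 0)).
  exact: is_derive_comp_scalar.
have De : is_derive x v (fun y : 'rV[R]_3 => expR (y 0 1)) (v 0 1 * expR (x 0 1)).
  exact: is_derive_comp_scalar.
have Dn : is_derive x v (fun y : 'rV[R]_3 => expR (- y 0 1)) (- v 0 1 * expR (- x 0 1)).
  by apply: (@is_derive_comp_scalar R _ expR (fun y : 'rV[R]_3 => - y 0 1)).
have entry (f : 'rV[R]_3 -> R) i j df : (forall y, covering y i j = f y) ->
    is_derive x v f df -> 'D_v (fun y => covering y i j) x = df.
  by move=> /funext -> df'; exact: derive_val.
rewrite (entry _ 0 0 _ _ (is_derive_mul Dc De)); last by move=> y; rewrite coveringE mx2E.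
rewrite (entry _ 1 0 _ _ (is_derive_mul Ds De)); last by move=> y; rewrite coveringE mx2E.
rewrite (entry _ 1 1 _ _ (is_derive_add (is_derive_mul (is_derive_mul Ds De) D2)
  (is_derive_mul Dc Dn))); last by move=> y; rewrite coveringE mx2E.
rewrite (entry _ 0 1 _ _ (is_derive_sub (is_derive_mul (is_derive_mul Dc De) D2)
  (is_derive_mul Ds Dn))); last by move=> y; rewrite coveringE mx2E.
rewrite coveringE /sl2_of /coframe !mxE !sum3 !mxE /= mx2M.
have -> : expR (2 * x 0 1) = expR (x 0 1) ^+ 2 by rewrite expRM_natl.
have -> : expR (- 2 * x 0 1) = expR (x 0 1) ^- 2.
  by rewrite mulNr expRN expRM_natl.
have : expR (x 0 1) != 0 by rewrite gt_eqF ?expR_gt0.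
rewrite expRN; move: (expR (x 0 1)) (cos (x 0 0)) (sin (x 0 0)) => E c s E0.
congr mx2; by field.
Qed.

Lemma diff_covering0 (R : realType) (v : 'rV[R]_3) :
  'd (@covering R) (0 : 'rV[R]_3) v = sl2_of v.
Proof. by rewrite diff_covering coframe0 covering0 mulmx1 mul1mx. Qed.

Lemma diff_covering_mulGl (R : realType) (a x v : 'rV[R]_3) :
  'd (@covering R) (mulG a x) ('d (mulG a) x v) = covering a *m 'd (@covering R) x v.
Proof.
have da := differentiable_mulGl a x.
have dc y := @differentiable_covering R y.
etransitivity.
  exact: esym (@diff_compE R _ _ _ (mulG a) (@covering R) x v da (dc (mulG a x))).
have dca : differentiable (@covering R \o mulG a) x by exact: differentiable_comp.
apply/matrixP => i j; rewrite (diff_mxE _ _ _ dca) mxE.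
have -> : (fun y => (@covering R \o mulG a) y i j) =
    (fun y => \sum_k covering a i k * covering y k j).
  by apply/funext => y /=; rewrite coveringM mxE.
apply: derive_val; apply: is_derive_sum_fun => k.
have := is_derive_mul (is_derive_cst (covering a i k) x v)
  (is_derive_mxE v k j (dc x)).
by rewrite mul0r add0r.
Qed.

Lemma diff_covering_mulGr (R : realType) (a x v : 'rV[R]_3) :
  'd (@covering R) (mulG x a) ('d ((@mulG R)^~ a) x v) =
  'd (@covering R) x v *m covering a.
Proof.
have da := differentiable_mulGr a x.
have dc y := @differentiable_covering R y.
etransitivity.
  exact: esym (@diff_compE R _ _ _ ((@mulG R)^~ a) (@covering R) x v da (dc (mulG x a))).
have dca : differentiable (@covering R \o (@mulG R)^~ a) x by exact: differentiable_comp.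
apply/matrixP => i j; rewrite (diff_mxE _ _ _ dca) mxE.
have -> : (fun y => (@covering R \o (@mulG R)^~ a) y i j) =
    (fun y => \sum_k covering y i k * covering a k j).
  by apply/funext => y /=; rewrite coveringM mxE.
apply: derive_val; apply: is_derive_sum_fun => k.
have := is_derive_mul (is_derive_mxE v i k (dc x))
  (is_derive_cst (covering a k j) x v).
by rewrite mulr0 addr0.
Qed.

Lemma covering_inv_mul (R : realType) (x : 'rV[R]_3) :
  covering (invG x) *m covering x = 1%:M.
Proof. by rewrite -coveringM mulVG covering0. Qed.

Lemma diff_covering_inv (R : realType) (a x y v d : 'rV[R]_3) :
  y = 0 -> covering a *m covering x = 1%:M ->
  'd (@covering R) y d = covering a *m 'd (@covering R) x v -> d = v *m coframe x.
Proof.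
move=> -> cax e; apply: (@sl2_of_inj R).
have := etrans (esym (diff_covering0 d))
  (etrans e (congr1 (mulmx (covering a)) (diff_covering x v))).
by rewrite mulmxA cax mul1mx.
Qed.

(** Translation to the unit is read in the covered group, because the covering map
    is an immersion at the unit. *)
Lemma diff_mulVG (R : realType) (x v : 'rV[R]_3) :
  'd (mulG (invG x)) x v = v *m coframe x.
Proof.
exact: diff_covering_inv (mulVG x) (covering_inv_mul x) (diff_covering_mulGl _ _ _).
Qed.

(** * Left-invariant metrics and the Killing metric *)

Lemma left_invariantE (R : realType) (h : 'rV[R]_3 -> 'M[R]_3) x v w :
  left_invariant h ->
  metric_ip h x v w = metric_ip h 0 (v *m coframe x) (w *m coframe x).
Proof. by move=> hl; rewrite -(hl (invG x)) mulVG !diff_mulVG. Qed.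

Lemma left_invariant_mx (R : realType) (h : 'rV[R]_3 -> 'M[R]_3) x :
  left_invariant h -> h x = coframe x *m h 0 *m (coframe x)^T.
Proof.
move=> hl; apply/matrixP => i j.
rewrite -[LHS](metric_ip_delta h x i j) left_invariantE //.
rewrite -[RHS](metric_ip_delta (fun=> coframe x *m h 0 *m (coframe x)^T) 0 i j).
by rewrite /metric_ip trmx_mul !mulmxA.
Qed.

(** Gram matrix of the Killing form in the basis (J, H, E). *)
Definition killing_gram (R : realType) : 'M[R]_3 :=
  mx3 (- 8) 0 4
      0 8 0
      4 0 0.

Lemma killing_sl2_of (R : realType) (v w : 'rV[R]_3) :
  killing (sl2_of v) (sl2_of w) = (v *m killing_gram R *m w^T) 0 0.
Proof.
rewrite killingE ?mxtrace_sl2_of // mx2M tr_mx2 mxE sum3 !mxE !sum3 !mxE /=.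
ring.
Qed.

Lemma killing_metricE (R : realType) (x v w : 'rV[R]_3) :
  killing_metric x v w = killing (sl2_of (v *m coframe x)) (sl2_of (w *m coframe x)).
Proof. by rewrite /killing_metric !diff_covering0 !diff_mulVG. Qed.

Lemma mxtrace_conj (R : comPzRingType) n (A B X Y : 'M[R]_n) :
  A *m B = 1%:M -> \tr ((B *m X *m A) *m (B *m Y *m A)) = \tr (X *m Y).
Proof.
move=> AB; rewrite mxtrace_mulC !mulmxA -(mulmxA _ A B) AB mulmx1.
by rewrite -!mulmxA mxtrace_mulC !mulmxA -!(mulmxA _ A B) AB !mulmx1 mxtrace_mulC.
Qed.

(** Under the identification of tangent spaces with sl(2,R), the right translation
    by a acts as Ad(a^-1). *)
Lemma coframe_mulGr (R : realType) (a x u : 'rV[R]_3) :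
  sl2_of ('d ((@mulG R)^~ a) x u *m coframe (mulG x a)) =
  covering (invG a) *m sl2_of (u *m coframe x) *m covering a.
Proof.
have cancel (A A' X X' S T : 'M[R]_2) : A' *m A = 1%:M -> X' *m X = 1%:M ->
    X *m A *m S = X *m T *m A -> S = A' *m T *m A.
  move=> A'A X'X /(congr1 (fun M => A' *m (X' *m M))).
  by rewrite !mulmxA -!(mulmxA A') X'X !mul1mx !mulmxA A'A mul1mx.
apply: cancel (covering_inv_mul a) (covering_inv_mul x) _.
rewrite -coveringM; apply: etrans (esym (diff_covering _ _)) _.
exact: etrans (diff_covering_mulGr a x u)
  (congr1 (mulmx^~ (covering a)) (diff_covering x u)).
Qed.

Lemma killing_metric_right_invariant (R : realType) (a x v w : 'rV[R]_3) :
  killing_metric (mulG x a) ('d ((@mulG R)^~ a) x v) ('d ((@mulG R)^~ a) x w) =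
  killing_metric x v w.
Proof.
rewrite (killing_metricE (mulG x a)) (killing_metricE x).
rewrite !killingE ?mxtrace_sl2_of // !coframe_mulGr mxtrace_conj //.
exact: mulmx1C (covering_inv_mul a).
Qed.

(** * The 2-jet of a left-invariant metric at the unit *)

Definition dcoframe (R : realType) (v x : 'rV[R]_3) : 'M[R]_3 :=
  let p := expR (2 * x 0 1) in let q := expR (- 2 * x 0 1) in let u := x 0 2 in
  mx3 (2 * v 0 1 * p) (- (2 * v 0 1 * p * u + p * v 0 2))
        (2 * v 0 1 * p + 2 * v 0 1 * q
         - (2 * v 0 1 * p * u ^+ 2 + 2 * p * u * v 0 2))
      0 0 (2 * v 0 2)
      0 0 0.

(** The second derivatives of the coframe are taken at the unit only, where the
    exponentials are 1 and u = 0. *)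
Definition ddcoframe0 (R : realType) (v w : 'rV[R]_3) : 'M[R]_3 :=
  mx3 (4 * v 0 1 * w 0 1) (- (2 * v 0 1 * w 0 2 + 2 * w 0 1 * v 0 2))
        (- (2 * v 0 2 * w 0 2))
      0 0 0
      0 0 0.

Section CoframeDerivatives.
Variables (R : realType) (x v : 'rV[R]_3).
Notation is_d := (is_derive x v).

Let Dp : is_d (fun y => expR (2 * y 0 1)) (2 * v 0 1 * expR (2 * x 0 1)).
Proof.
apply: (@is_derive_comp_scalar R _ expR (fun y : 'rV[R]_3 => 2 * y 0 1)).
have := is_derive_mul (is_derive_cst (2 : R) x v) (is_derive_coord x v 0 1).
by rewrite mul0r add0r.
Qed.

Let Dq : is_d (fun y => expR (- 2 * y 0 1)) (- 2 * v 0 1 * expR (- 2 * x 0 1)).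
Proof.
apply: (@is_derive_comp_scalar R _ expR (fun y : 'rV[R]_3 => - 2 * y 0 1)).
have := is_derive_mul (is_derive_cst (- 2 : R) x v) (is_derive_coord x v 0 1).
by rewrite mul0r add0r.
Qed.

Let Du : is_d (fun y => y 0 2) (v 0 2) := is_derive_coord x v 0 2.

Let Dc (c : R) : is_d (fun=> c) 0 := is_derive_cst c x v.

Let Dopp (f : 'rV[R]_3 -> R) a : is_d f a -> is_d (fun y => - f y) (- a).
Proof. by move=> df; exact: is_deriveN. Qed.

Lemma is_mx_derive_coframe : is_mx_derive (@coframe R) x v (dcoframe v x).
Proof.
apply: is_mx_derive_mx3 => //.
- exact: is_derive_eq (Dopp (is_derive_mul Dp Du)) _.
- apply: is_derive_eq (is_derive_sub (is_derive_sub Dp Dq)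
    (is_derive_mul Dp (is_derive_mul Du Du))) _.
  by rewrite expr2; ring.
- by apply: is_derive_eq (is_derive_mul (Dc 2) Du) _; ring.
Qed.

Lemma is_mx_derive_dcoframe (w : 'rV[R]_3) : x = 0 ->
  is_mx_derive (dcoframe w) x v (ddcoframe0 w v).
Proof.
move=> x0; have p1 : expR (2 * x 0 1) = 1 by rewrite x0 mxE mulr0 expR0.
have q1 : expR (- 2 * x 0 1) = 1 by rewrite x0 mxE mulr0 expR0.
have u0 : x 0 2 = 0 by rewrite x0 mxE.
have Dvp := is_derive_mul (Dc (2 * w 0 1)) Dp.
apply: is_mx_derive_mx3 => //.
- by apply: is_derive_eq Dvp _; rewrite p1; ring.
- apply: is_derive_eq (Dopp (is_derive_add (is_derive_mul Dvp Du)
    (is_derive_mul Dp (Dc (w 0 2))))) _.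
  by rewrite p1 u0; ring.
- apply: is_derive_eq (is_derive_sub
    (is_derive_add Dvp (is_derive_mul (Dc (2 * w 0 1)) Dq))
    (is_derive_add (is_derive_mul Dvp (is_derive_mul Du Du))
      (is_derive_mul (is_derive_mul (is_derive_mul (Dc 2) Dp) Du) (Dc (w 0 2))))) _.
  by rewrite p1 q1 u0; ring.
Qed.
End CoframeDerivatives.

(** First derivative of C(x) G C(x)^T in the direction v. *)
Definition metric_jet1 (R : realType) (G : 'M[R]_3) (x v : 'rV[R]_3) : 'M[R]_3 :=
  dcoframe v x *m G *m (coframe x)^T + coframe x *m G *m (dcoframe v x)^T.

(** Second derivative of C(x) G C(x)^T at the unit in the directions v and w. *)
Definition metric_jet2 (R : realType) (G : 'M[R]_3) (v w : 'rV[R]_3) : 'M[R]_3 :=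
  ddcoframe0 v w *m G + dcoframe v 0 *m G *m (dcoframe w 0)^T
  + (dcoframe w 0 *m G *m (dcoframe v 0)^T + G *m (ddcoframe0 v w)^T).

Section MetricJet.
Variables (R : realType) (h : 'rV[R]_3 -> 'M[R]_3).
Hypothesis h_left : left_invariant h.
Let G := h 0.

Lemma is_mx_derive_metric x v : is_mx_derive h x v (metric_jet1 G x v).
Proof.
have -> : h = (fun y => coframe y *m G *m (coframe y)^T).
  by apply/funext => y; exact: left_invariant_mx.
by apply: is_mx_derive_congr; exact: is_mx_derive_coframe.
Qed.

Lemma partial_metric_jet k i j :
  partial k (fun y => h y i j) = (fun x => metric_jet1 G x (delta_mx 0 k) i j).
Proof.
by apply/funext => x; apply: derive_val; exact: is_mx_derive_metric.
Qed.

Lemma is_mx_derive_metric_jet1 v w :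
  is_mx_derive (fun x => metric_jet1 G x v) 0 w (metric_jet2 G v w).
Proof.
have hC := is_mx_derive_coframe (0 : 'rV[R]_3) w.
have hD : is_mx_derive (dcoframe v) 0 w (ddcoframe0 v w) by exact: is_mx_derive_dcoframe.
have := is_mx_deriveD (is_mx_derive_congr G hD hC) (is_mx_derive_congr G hC hD).
by rewrite coframe0 trmx1 !mulmx1 !mul1mx.
Qed.

Lemma partial_christoffel1 a l i j :
  let DD v w := metric_jet2 G (delta_mx 0 v) (delta_mx 0 w) in
  partial a (christoffel1 h l i j) 0 =
  2^-1 * (DD i a j l + DD j a i l - DD l a i j).
Proof.
move=> DD; apply: derive_val.
have -> : christoffel1 h l i j = (fun x =>
    2^-1 * (metric_jet1 G x (delta_mx 0 i) j l + metric_jet1 G x (delta_mx 0 j) i l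
            - metric_jet1 G x (delta_mx 0 l) i j)).
  by apply/funext => x; rewrite /christoffel1 !partial_metric_jet.
have hD v j' k' : is_derive (0 : 'rV[R]_3) (delta_mx 0 a)
    (fun x => metric_jet1 G x (delta_mx 0 v) j' k') (DD v a j' k').
  exact: is_mx_derive_metric_jet1.
have := is_derive_mul (is_derive_cst (2^-1 : R) (0 : 'rV[R]_3) (delta_mx 0 a))
  (is_derive_sub (is_derive_add (hD i j l) (hD j i l)) (hD l i j)).
by rewrite mul0r add0r.
Qed.

Lemma christoffel1_0 l i j :
  let D v := metric_jet1 G 0 (delta_mx 0 v) in
  christoffel1 h l i j 0 = 2^-1 * (D i j l + D j i l - D l i j).
Proof. by rewrite /christoffel1 !partial_metric_jet. Qed.
End MetricJet.

(** * The curvature at the unit as a polynomial in the Gram matrix *)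

(** The value at the unit of the symbol of the first kind, see [christoffel1_0]. *)
Definition christoffel1_unit (R : realType) (G : 'M[R]_3) (l i j : 'I_3) : R :=
  let D v := metric_jet1 G 0 (delta_mx 0 v) in
  2^-1 * (D i j l + D j i l - D l i j).

(** The derivative at the unit, in the direction a, of the symbol of the first kind,
    see [partial_christoffel1]. *)
Definition dchristoffel1_unit (R : realType) (G : 'M[R]_3) (a l i j : 'I_3) : R :=
  let DD v w := metric_jet2 G (delta_mx 0 v) (delta_mx 0 w) in
  2^-1 * (DD i a j l + DD j a i l - DD l a i j).

(** Multiplying by det G turns the inverse metric into the adjugate, and the
    curvature into a polynomial in the entries of G. *)
Definition scaled_riemann (R : realType) (G : 'M[R]_3) (m k i j : 'I_3) : R :=
  \det G * (dchristoffel1_unit G i m j k - dchristoffel1_unit G j m i k)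
  - \sum_l christoffel1_unit G l i m * (\sum_n (\adj G) l n * christoffel1_unit G n j k)
  + \sum_l christoffel1_unit G l j m * (\sum_n (\adj G) l n * christoffel1_unit G n i k).

Lemma det_riemann_low (R : realType) (h : 'rV[R]_3 -> 'M[R]_3) m k i j :
  (forall i j, smooth (fun x => h x i j)) -> (forall x, (h x)^T = h x) ->
  (forall x, h x \in unitmx) -> left_invariant h ->
  \det (h 0) * riemann_low h m k i j 0 = scaled_riemann (h 0) m k i j.
Proof.
move=> hs hsym hu hl.
have hd : \det (h 0) != 0 by rewrite -unitfE -unitmxE.
have dG l i' j' : \det (h 0) * christoffel h l i' j' 0 =
    \sum_n (\adj (h 0)) l n * christoffel1_unit (h 0) n i' j'.
  rewrite christoffelE mulr_sumr; apply: eq_bigr => n _.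
  rewrite christoffel1_0 // mulrA; congr (_ * _).
  by rewrite /invmx hu mxE mulrA divff ?mul1r.
have dS a b c d : \det (h 0) * (\sum_l christoffel1 h l a b 0 * christoffel h l c d 0)
    = \sum_l christoffel1_unit (h 0) l a b
      * (\sum_n (\adj (h 0)) l n * christoffel1_unit (h 0) n c d).
  by rewrite mulr_sumr; apply: eq_bigr => l _; rewrite -dG christoffel1_0 // mulrCA.
have e := @riemann_lowE R h hs hsym hu m k i j 0.
rewrite e /scaled_riemann -!dS !partial_christoffel1 //.
rewrite /dchristoffel1_unit.
by rewrite mulrDr mulrBr.
Qed.

(** The symmetric tensor N of the bracket: its columns are
    [H, E] = 2 E, [E, J] = H and [J, H] = 2 J + 4 E in the basis (J, H, E).
    The operator L of the bracket is N G, up to the factor that normalizes the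
    volume form. *)
Definition bracket_tensor (R : realType) : 'M[R]_3 := mx3 0 0 2 0 1 0 2 0 4.

(** The operator M = tr L / 2 - L of the Levi-Civita connection, up to the same
    factor; its adjugate is the Ricci operator up to a factor. *)
Definition connection_mx (R : realType) (G : 'M[R]_3) : 'M[R]_3 :=
  (2^-1 * \tr (bracket_tensor R *m G))%:M - bracket_tensor R *m G.

(** The matrix of the quadratic form b |-> - det G <R(v, w) w, v> on bivectors,
    where b is the cross product of the coordinates of v and w: the operator
    2 adj M - tr (adj M) of the curvature, composed with the form
    b |-> b^T (adj G) b, which is <v, v> <w, w> - <v, w>^2. *)
Definition curv_mx (R : realType) (G : 'M[R]_3) : 'M[R]_3 :=
  (2 *: \adj (connection_mx G) - (\tr (\adj (connection_mx G)))%:M) *m \adj G.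

Definition sym3 (R : realType) (a b c d e f : R) : 'M[R]_3 := mx3 a b c b d e c e f.

Lemma adj_sym3 (R : realType) (a b c d e f : R) :
  \adj (sym3 a b c d e f) =
  sym3 (d * f - e ^+ 2) (c * e - b * f) (b * e - c * d)
       (a * f - c ^+ 2) (b * c - a * e) (a * d - b ^+ 2).
Proof. by rewrite /sym3 adj_mx3; congr mx3; ring. Qed.

Lemma det_sym3 (R : realType) (a b c d e f : R) :
  \det (sym3 a b c d e f) =
  a * (d * f - e ^+ 2) + b * (c * e - b * f) + c * (b * e - c * d).
Proof. by rewrite /sym3 det_mx3; ring. Qed.

Lemma metric_jet1_sym3 (R : realType) (a b c d e f : R) (v : 'rV[R]_3) :
  let x := v 0 1 in let y := v 0 2 in
  metric_jet1 (sym3 a b c d e f) 0 v =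
  sym3 (2 * (2 * x * a - y * b + 4 * x * c))
       (2 * x * b - y * d + 4 * x * e + 2 * y * c) (2 * x * c - y * e + 4 * x * f)
       (4 * y * e) (2 * y * f) 0.
Proof.
move=> x y; rewrite /metric_jet1 coframe0 trmx1 mulmx1 mul1mx /dcoframe !mxE.
rewrite !mulr0 expR0 -/x -/y /sym3 trmx_mx3 !mx3M mx3D; congr mx3; ring.
Qed.

Lemma metric_jet2_sym3 (R : realType) (a b c d e f : R) (v w : 'rV[R]_3) :
  let x := v 0 1 in let y := v 0 2 in let z := w 0 1 in let t := w 0 2 in
  metric_jet2 (sym3 a b c d e f) v w =
  sym3 (2 * (4 * x * z * a - 2 * (x * t + z * y) * b - 2 * y * t * c)
        + 2 * (2 * x * (2 * z * a - t * b + 4 * z * c)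
               - y * (2 * z * b - t * d + 4 * z * e)
               + 4 * x * (2 * z * c - t * e + 4 * z * f)))
       (4 * x * z * b - 2 * (x * t + z * y) * d - 2 * y * t * e
        + 2 * (2 * x * t * c - y * t * e + 4 * x * t * f)
        + 2 * (2 * z * y * c - t * y * e + 4 * z * y * f))
       (4 * x * z * c - 2 * (x * t + z * y) * e - 2 * y * t * f)
       (8 * y * t * f) 0 0.
Proof.
move=> x y z t; rewrite /metric_jet2 /ddcoframe0 /dcoframe [in 2 * (0 : 'rV[R]_3) 0 1]mxE.
rewrite [in - 2 * (0 : 'rV[R]_3) 0 1]mxE ![(0 : 'rV[R]_3) _ _]mxE.
rewrite !mulr0 expR0 -/x -/y -/z -/t /sym3 !trmx_mx3 !mx3M !mx3D; congr mx3; ring.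
Qed.

Lemma christoffel1_unit_sym3 (R : realType) (a b c d e f : R) (l i j : 'I_3) :
  christoffel1_unit (sym3 a b c d e f) l i j =
  nth 0 [:: sym3 0 (2 * a + 4 * c) (- b) (2 * b + 4 * e) (2 * c + 2 * f - 2^-1 * d) (- e);
            sym3 (- 2 * a - 4 * c) 0 (- 2^-1 * d - 2 * f) 0 (2 * e) (2 * f);
            sym3 b (2 * f + 2^-1 * d) 0 (- 2 * e) 0 0] l i j.
Proof.
rewrite /christoffel1_unit !metric_jet1_sym3 !mxE.
by case: l => [[|[|[|//]]] p]; case: i => [[|[|[|//]]] q]; case: j => [[|[|[|//]]] r];
  rewrite /= ?mxE /=; field.
Qed.

Lemma connection_mx_sym3 (R : realType) (a b c d e f : R) :
  connection_mx (sym3 a b c d e f) =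
  mx3 (2^-1 * d + 2 * f) (- 2 * e) (- 2 * f)
      (- b) (2 * c - 2^-1 * d + 2 * f) (- e)
      (- 2 * a - 4 * c) (- 2 * b - 4 * e) (2^-1 * d - 2 * f).
Proof.
rewrite /connection_mx /bracket_tensor /sym3 mx3M mxtrace_mx3 scalar_mx3 mx3N mx3D.
by congr mx3; field.
Qed.

(** Twice the (m, i) entry of the symmetric matrix of the quadratic form
    v |-> det G <R(v, e_j) e_j, v>. *)
Definition jacobi_sum (R : realType) (G : 'M[R]_3) (j m i : 'I_3) : R :=
  scaled_riemann G m j i j + scaled_riemann G i j m j.

Section Scaled.
Variables (R : realType) (a b c d e f : R).
Let G := sym3 a b c d e f.

(** The six entries of the symmetric matrix [curv_mx G] are recovered from the
    planes that contain a basis vector: if w = e_j, then b runs over the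
    bivectors whose j-th coordinate is 0. *)
Lemma jacobi_sum_00 : jacobi_sum G 2 1 1 = - 2 * curv_mx G 0 0.
Proof.
rewrite /curv_mx connection_mx_sym3 adj_sym3 adj_mx3 mxtrace_mx3 scalar_mx3.
rewrite mx3Z mx3N mx3D {1}/sym3 mx3M [in RHS]mxE /=.
rewrite /jacobi_sum /scaled_riemann adj_sym3 det_sym3 !sum3.
rewrite !christoffel1_unit_sym3 /= !mxE /=.
rewrite /dchristoffel1_unit !metric_jet2_sym3 !mxE /=.
by field.
Qed.

Lemma jacobi_sum_11 : jacobi_sum G 2 0 0 = - 2 * curv_mx G 1 1.
Proof.
rewrite /curv_mx connection_mx_sym3 adj_sym3 adj_mx3 mxtrace_mx3 scalar_mx3.
rewrite mx3Z mx3N mx3D {1}/sym3 mx3M [in RHS]mxE /=.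
rewrite /jacobi_sum /scaled_riemann adj_sym3 det_sym3 !sum3.
rewrite !christoffel1_unit_sym3 /= !mxE /=.
rewrite /dchristoffel1_unit !metric_jet2_sym3 !mxE /=.
by field.
Qed.

Lemma jacobi_sum_22 : jacobi_sum G 1 0 0 = - 2 * curv_mx G 2 2.
Proof.
rewrite /curv_mx connection_mx_sym3 adj_sym3 adj_mx3 mxtrace_mx3 scalar_mx3.
rewrite mx3Z mx3N mx3D {1}/sym3 mx3M [in RHS]mxE /=.
rewrite /jacobi_sum /scaled_riemann adj_sym3 det_sym3 !sum3.
rewrite !christoffel1_unit_sym3 /= !mxE /=.
rewrite /dchristoffel1_unit !metric_jet2_sym3 !mxE /=.
by field.
Qed.

Lemma jacobi_sum_01 : jacobi_sum G 2 0 1 = 2 * curv_mx G 0 1.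
Proof.
rewrite /curv_mx connection_mx_sym3 adj_sym3 adj_mx3 mxtrace_mx3 scalar_mx3.
rewrite mx3Z mx3N mx3D {1}/sym3 mx3M [in RHS]mxE /=.
rewrite /jacobi_sum /scaled_riemann adj_sym3 det_sym3 !sum3.
rewrite !christoffel1_unit_sym3 /= !mxE /=.
rewrite /dchristoffel1_unit !metric_jet2_sym3 !mxE /=.
by field.
Qed.

Lemma jacobi_sum_02 : jacobi_sum G 1 0 2 = 2 * curv_mx G 0 2.
Proof.
rewrite /curv_mx connection_mx_sym3 adj_sym3 adj_mx3 mxtrace_mx3 scalar_mx3.
rewrite mx3Z mx3N mx3D {1}/sym3 mx3M [in RHS]mxE /=.
rewrite /jacobi_sum /scaled_riemann adj_sym3 det_sym3 !sum3.
rewrite !christoffel1_unit_sym3 /= !mxE /=.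
rewrite /dchristoffel1_unit !metric_jet2_sym3 !mxE /=.
by field.
Qed.

Lemma jacobi_sum_12 : jacobi_sum G 0 1 2 = 2 * curv_mx G 1 2.
Proof.
rewrite /curv_mx connection_mx_sym3 adj_sym3 adj_mx3 mxtrace_mx3 scalar_mx3.
rewrite mx3Z mx3N mx3D {1}/sym3 mx3M [in RHS]mxE /=.
rewrite /jacobi_sum /scaled_riemann adj_sym3 det_sym3 !sum3.
rewrite !christoffel1_unit_sym3 /= !mxE /=.
rewrite /dchristoffel1_unit !metric_jet2_sym3 !mxE /=.
by field.
Qed.

Lemma curv_mx_sym : (curv_mx G)^T = curv_mx G.
Proof.
rewrite /curv_mx connection_mx_sym3 adj_sym3 adj_mx3 mxtrace_mx3 scalar_mx3.
rewrite mx3Z mx3N mx3D /sym3 mx3M trmx_mx3; congr mx3; by field.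
Qed.
End Scaled.

(** * Rigidity of the Gram matrix *)

(** Constant curvature K makes the form of [curv_mx (h 0)] equal to - K det G times
    the discriminant form, whose matrix is adj G. *)
Lemma curv_mx_const (R : realType) (h : 'rV[R]_3 -> 'M[R]_3) (K : R)
    (v w : 'rV[R]_3) :
  (forall i j, smooth (fun x => h x i j)) -> (forall x, (h x)^T = h x) ->
  (forall x, h x \in unitmx) -> left_invariant h ->
  constant_sectional_curvature h K -> plane_discr h 0 v w != 0 ->
  curv_mx (h 0) = - (K * \det (h 0)) *: \adj (h 0).
Proof.
move=> hs hsym hu hl hK vw0.
have sym i j : h 0 i j = h 0 j i by rewrite -[in LHS](hsym 0) mxE.
have hG : h 0 = sym3 (h 0 0 0) (h 0 0 1) (h 0 0 2) (h 0 1 1) (h 0 1 2) (h 0 2 2).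
  by rewrite [LHS]eq_mx3 (sym 1 0) (sym 2 0) (sym 2 1).
have key j m i : jacobi_sum (h 0) j m i =
    2 * K * \det (h 0) * (h 0 m i * h 0 j j - h 0 m j * h 0 i j).
  rewrite /jacobi_sum -!det_riemann_low // -mulrDr.
  by rewrite (const_curvature_riemann_low hsym j m i hK vw0) mulrCA !mulrA.
have := key 0 1 2; have := key 1 0 2; have := key 2 0 1; have := key 1 0 0.
have := key 2 0 0; have {key} := key 2 1 1.
rewrite (sym 1 0) (sym 2 0) (sym 2 1).
move: hG; move: (h 0 0 0) (h 0 0 1) (h 0 0 2) (h 0 1 1) (h 0 1 2) (h 0 2 2).
move=> a b c d e f ->; rewrite jacobi_sum_00 jacobi_sum_11 jacobi_sum_22.
rewrite jacobi_sum_01 jacobi_sum_02 jacobi_sum_12 => k00 k11 k22 k01 k02 k12.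
have curvC i j : curv_mx (sym3 a b c d e f) i j = curv_mx (sym3 a b c d e f) j i.
  by rewrite -{1}curv_mx_sym mxE.
rewrite [LHS]eq_mx3 (curvC 1 0) (curvC 2 0) (curvC 2 1) adj_sym3 /sym3 mx3Z.
move: k00 k11 k22 k01 k02 k12; rewrite -/(sym3 a b c d e f).
move: (curv_mx _) (\det _) => X D k00 k11 k22 k01 k02 k12.
by congr mx3; lra.
Qed.

(** Since M (adj M) = det M. *)
Lemma adj_scalar (R : fieldType) n (M : 'M[R]_n) (k : R) :
  k != 0 -> \adj M = k%:M -> M = (k^-1 * \det M)%:M.
Proof.
move=> k0 adjM; have := mul_mx_adj M; rewrite adjM mul_mx_scalar.
move=> /(congr1 (fun A => k^-1 *: A)).
by rewrite scalerA mulVf // scale1r scale_scalar_mx.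
Qed.

(** After cancelling adj G, the hypothesis is 2 adj M - tr (adj M) = - K det G;
    its trace is tr (adj M) = 3 K det G, whence adj M = K det G. *)
Lemma curv_mx_killing (R : realType) (G : 'M[R]_3) (K : R) :
  K != 0 -> G \in unitmx -> curv_mx G = - (K * \det G) *: \adj G ->
  exists2 c, c != 0 & G = c *: killing_gram R.
Proof.
move=> K0 uG eG.
have d0 : \det G != 0 by rewrite -unitfE -unitmxE.
set M := connection_mx G; set t := \tr (\adj M).
have e1 : 2 *: \adj M - t%:M = (- (K * \det G))%:M.
  have := congr1 (fun A => A *m G) eG.
  rewrite /curv_mx -/M -/t -mulmxA mul_adj_mx -scalemxAl mul_adj_mx.
  rewrite mul_mx_scalar scale_scalar_mx => /(congr1 (fun A => (\det G)^-1 *: A)).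
  by rewrite scalerA mulVf // scale1r scale_scalar_mx mulrC mulfK.
have et : t = 3 * (K * \det G).
  have := congr1 mxtrace e1.
  rewrite linearB linearZ /= -/t !mxtrace_scalar => e; lra.
have adjM : \adj M = (K * \det G)%:M.
  have : 2 *: \adj M = 2 *: (K * \det G)%:M.
    rewrite -[LHS](subrK t%:M) e1 et scale_scalar_mx -(raddfD (@scalar_mx R 3)).
    congr (_%:M); ring.
  by apply: scalerI; rewrite pnatr_eq0.
have k0 : K * \det G != 0 by rewrite mulf_neq0.
have eM := adj_scalar k0 adjM.
have [c eN] : exists c, bracket_tensor R *m G = c%:M.
  set s := 2^-1 * \tr (bracket_tensor R *m G).
  exists (s - (K * \det G)^-1 * \det M).
  apply: etrans (esym (raddfB (@scalar_mx R 3) _ _)).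
  apply: etrans (congr1 (fun A => s%:M - A) eM).
  by rewrite /M /connection_mx subKr.
have KN : killing_gram R *m bracket_tensor R = 8%:M.
  by rewrite /killing_gram /bracket_tensor mx3M scalar_mx3; congr mx3; ring.
have eG8 : G = (c / 8) *: killing_gram R.
  have := congr1 (mulmx (killing_gram R)) eN.
  rewrite mulmxA KN mul_scalar_mx mul_mx_scalar => /(congr1 (fun A => 8^-1 *: A)).
  by rewrite !scalerA mulVf ?pnatr_eq0 // scale1r mulrC.
exists (c / 8) => //; apply: contraNneq d0 => c0.
by rewrite eG8 c0 scale0r det0.
Qed.

Theorem proposition6p1 (R : realType) (h : 'rV[R]_3 -> 'M[R]_3)
    (h_lorentzian : lorentzian_metric h)
    (h_left_invariant : left_invariant h)
    (h_curvature : exists2 K : R, K != 0 & constant_sectional_curvature h K) :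
  bi_invariant h /\
  exists2 c : R, c != 0 &
    forall x v w : 'rV[R]_3, metric_ip h x v w = c * killing_metric x v w.
Proof.
have [hs hsym hP] := h_lorentzian; have [K K0 hK] := h_curvature.
have hu x : h x \in unitmx.
  have [P uP eP] := hP x.
  have : P *m h x *m P^T \in unitmx.
    rewrite eP unitmxE det_diag !big_ord_recl big_ord0 !mxE /= unitfE.
    by rewrite !mulr1 oppr_eq0 oner_eq0.
  by rewrite !unitmx_mul => /andP[/andP[]].
have [v [w vw0]] : exists v w, plane_discr h 0 v w != 0.
  have [P _ /matrixP eP] := hP 0.
  have hPE i j : metric_ip h 0 (row i P) (row j P) = (P *m h 0 *m P^T) i j.
    by rewrite /metric_ip tr_row -!row_mul colE mulmxA -colE 2!mxE.
  (* The rows of P are pseudo-orthonormal: rows 0 and 1 have discriminant -1. *)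
  exists (row 0 P), (row 1 P).
  rewrite /plane_discr !hPE !eP !mxE /= ?mulr1n ?mulr0n expr0n subr0.
  by rewrite mulr1 oppr_eq0 oner_eq0.
have [c c0 hG] := curv_mx_killing K0 (hu 0)
  (curv_mx_const hs hsym hu h_left_invariant hK vw0).
have hc x v' w' : metric_ip h x v' w' = c * killing_metric x v' w'.
  rewrite left_invariantE // killing_metricE killing_sl2_of /metric_ip hG.
  by rewrite -scalemxAr -scalemxAl mxE.
split; last by exists c.
split; first exact: h_left_invariant.
move=> a x v' w'; rewrite !hc; congr (_ * _).
exact: killing_metric_right_invariant.
Qed.
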